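(* Let $n$ be sufficiently large and let $G$ be a graph with $n$ vertices and edge density $p$. Then $G$ contains a weakly bi-complete $r$-sequence of order $t$ if any of the following holds: (1) $p\ge n^{-1/3}$, $r\le 2p^{-1/2}$ and $t\le \frac{\log n}{4\log(32/(pr^2))}$; (2) $p\ge n^{-1/5}$, $4p^{-1/2}\le r\le\sqrt{p^{-1}\log n}$ and $t\le\frac{1}{16}e^{pr^2/8}\log n$; (3) $r\ge 4\sqrt{p^{-1}\log n}$ and $t\le\min\left(pn/(64\sqrt{\log n}),\,n/(2r)\right)$. In particular, in each case $G$ also contains a weakly complete $2r$-sequence of order $t$.
   Context: All logarithms are base 2. The edge density of a graph on $n$ vertices with $e$ edges is $e/\binom{n}{2}$. A sequence $S_1,\ldots,S_t$ of pairwise disjoint vertex subsets of a graph is a weakly complete $r$-sequence of order $t$ if $|S_i|=r$ for all $i$ and for each $1\le i<j\le t$ there is an edge between a vertex of $S_i$ and a vertex of $S_j$. A sequence $S_1,\ldots,S_t,T_1,\ldots,T_t$ of pairwise disjoint vertex subsets is a weakly bi-complete $r$-sequence of order $t$ if $|S_i|=|T_i|=r$ for all $i$ and for each pair $1\le i,j\le t$ there is an edge between a vertex of $S_i$ and a vertex of $T_j$. *)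

(* Defs.v *)
From HB Require Import structures.
From mathcomp Require Import all_boot all_order all_algebra.
From mathcomp Require Import reals sequences exp.

Set Implicit Arguments.
Unset Strict Implicit.
Unset Printing Implicit Defensive.

Import Order.TTheory GRing.Theory Num.Theory.
Local Open Scope ring_scope.

Record sgraph := SGraph {
  vertex :> finType;
  adj : rel vertex;
  adj_sym : symmetric adj;
  adj_irrefl : irreflexive adj
}.

Definition edges (G : sgraph) : {set {set G}} :=
  [set [set x; y] | x in G, y in G & adj x y].

Definition edge_density (R : realType) (G : sgraph) : R :=
  #|edges G|%:R / ('C(#|G|, 2))%:R.

Definition log2 (R : realType) (x : R) : R := ln x / ln 2.

Definition edge_between (G : sgraph) (A B : {set G}) : Prop :=
  exists x y : G, [/\ x \in A, y \in B & adj x y].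

Definition weakly_complete (G : sgraph) (r t : nat) (S : 'I_t -> {set G}) :
    Prop :=
  [/\ forall i, #|S i| = r,
      forall i j, i != j -> [disjoint S i & S j]
    & forall i j : 'I_t, (i < j)%N -> edge_between (S i) (S j)].

Definition weakly_bicomplete (G : sgraph) (r t : nat)
    (S T : 'I_t -> {set G}) : Prop :=
  [/\ forall i, #|S i| = r /\ #|T i| = r,
      forall i j, i != j -> [disjoint S i & S j] /\ [disjoint T i & T j],
      forall i j, [disjoint S i & T j]
    & forall i j, edge_between (S i) (T j)].

Definition has_weakly_complete (G : sgraph) (r t : nat) : Prop :=
  exists S : 'I_t -> {set G}, weakly_complete r S.

Definition has_weakly_bicomplete (G : sgraph) (r t : nat) : Prop :=
  exists S T : 'I_t -> {set G}, weakly_bicomplete r S T.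

(* Main.v *)
(** Averaging over balanced cuts and discarding vertices of small degree yields
    disjoint sets [A], [B] such that every vertex of [B] has at least [p n / 5]
    neighbours in [A] while [#|B| >= sqrt p * n / 5]: if the rich vertices on one
    side of the cut are too few, their edges are spread over many rich vertices
    on the other side.

    Cases (1) and (2): because of the minimum degree, greedy choices give many
    disjoint [r]-sets [S] in [A] that miss at most a [(1 - p/3)^r] fraction of
    [B], so an average [r]-set [T] of [B] misses only an [exp (- p r^2 / 3)]
    fraction of them.  A Kovari-Sos-Turan argument selects [t] of the [S] that
    are all hit by a positive proportion of the [r]-sets of [B], and such a dense
    family of [r]-sets contains [t] disjoint members.

    Case (3): it suffices to work with sets of size
    [r0 = ceil (4 sqrt (log n / p))], enlarged to size [r] at the end.  Once [t]
    disjoint [S] in [A], each missing a small fraction of [B], are known, a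
    random disjoint family of [2 t] subsets of [B] contains [t] members that hit
    them all.  If [r0 <= 6 log n], the [S] also come from a random family and
    Markov's inequality; otherwise they are built greedily, so that the degree
    mass consumed by each [S] is at most [#|B|]. *)
Require Import Defs.
From mathcomp Require Import all_boot all_order all_algebra.
From mathcomp Require Import reals sequences exp.
From mathcomp Require Import zify ring lra.
Set Implicit Arguments.
Unset Strict Implicit.
Unset Printing Implicit Defensive.
Import Order.TTheory GRing.Theory Num.Theory.
Local Open Scope ring_scope.

(** * Averaging over sequences and finite sets *)

Lemma exists_le_average_seq (R : realDomainType) (I : eqType) (s : seq I)
    (F : I -> R) (c : R) :
  (0 < size s)%N -> \sum_(i <- s) F i <= (size s)%:R * c ->
  exists2 i, i \in s & F i <= c.
Proof.
move=> s0 le_sum; have [/hasP[i i_s Fi] | /hasPn no] := boolP (has (fun i => F i <= c) s).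
  by exists i.
suff: (size s)%:R * c < \sum_(i <- s) F i by rewrite ltNge le_sum.
have {}no i : i \in s -> c < F i by move/no; rewrite -ltNge.
elim: s s0 no {le_sum} => //= i s IH _ no; rewrite big_cons -add1n natrD mulrDl mul1r.
have ci : c < F i by apply: no; rewrite mem_head.
case: s IH no => [|j s] IH no; first by rewrite big_nil mul0r !addr0.
by apply: ltrD => //; apply: IH => // k ks; apply: no; rewrite in_cons ks orbT.
Qed.

Lemma exists_le_average (R : realDomainType) (I : finType) (D : {set I})
    (F : I -> R) (c : R) :
  (0 < #|D|)%N -> \sum_(i in D) F i <= #|D|%:R * c ->
  exists2 i, i \in D & F i <= c.
Proof.
rewrite -big_enum cardE => D0 le_sum.
by have [i] := exists_le_average_seq D0 le_sum; rewrite mem_enum; exists i.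
Qed.

(** * Disjoint families of [k]-subsets with small values *)

Section Families.

Variables (R : realFieldType) (V : finType).
Implicit Types (A B S T : {set V}) (l : seq {set V}) (F : {set V} -> R).

Definition draws B k := [set T : {set V} | T \subset B & #|T| == k].

Definition disj : rel {set V} := fun S T => [disjoint S & T].

Lemma card_draws_in B k : #|draws B k| = 'C(#|B|, k).
Proof. exact: cards_draws. Qed.

Lemma drawsP B k T : reflect (T \subset B /\ #|T| = k) (T \in draws B k).
Proof.
rewrite inE; apply: (iffP andP) => [[? /eqP]|[? /eqP]]; by [].
Qed.

(** After multiplication by [k!] both binomials become falling factorials, and factor by factor
    [(x - i) / (b - i) <= x / b]. *)
Lemma bin_ratio_le x b k : (x <= b)%N -> ('C(x, k) * b ^ k <= x ^ k * 'C(b, k))%N.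
Proof.
move=> le_xb; rewrite -(@leq_pmul2r k`!) ?fact_gt0 // mulnAC bin_ffact -mulnA bin_ffact.
elim: k => [|k IH]; first by rewrite !ffactn0.
rewrite !ffactnSr !expnSr.
have le1 : ((x - k) * b <= x * (b - k))%N.
  by rewrite mulnBl mulnBr leq_sub2l // (mulnC k) leq_mul2r le_xb orbT.
have := leq_mul IH le1; lia.
Qed.

Lemma bin_le_exp (rho : R) x b k :
  (x <= b)%N -> x%:R <= rho * b%:R -> 'C(x, k)%:R <= rho ^+ k * 'C(b, k)%:R.
Proof.
move=> le_xb le_rho; have [b0|b0] := posnP b.
  move: le_xb; rewrite b0 leqn0 => /eqP ->.
  case: k => [|k]; first by rewrite expr0 mul1r.
  by rewrite bin0n mulr0.
have bk : 0 < b%:R ^+ k :> R by rewrite exprn_gt0 // ltr0n.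
rewrite -(ler_pM2r bk); have := bin_ratio_le k le_xb.
rewrite -(ler_nat R) !natrM !natrX => /le_trans; apply.
rewrite mulrAC ler_wpM2r // -exprMn lerXn2r // ?nnegrE ?ler0n //.
by rewrite (le_trans _ le_rho).
Qed.

(* Choosing [T1] to minimise [F T1] plus [m - 1] times the average of [F] over
   the [k]-subsets of [B :\: T1] derandomises a uniformly random family. *)
Lemma disjoint_draws_average F m B k :
  (m * k <= #|B|)%N ->
  exists l, [/\ size l = m, pairwise disj l, {subset l <= draws B k}
    & (\sum_(T <- l) F T) * 'C(#|B|, k)%:R <= m%:R * \sum_(T in draws B k) F T].
Proof.
elim: m B => [|m IH] B le_mB.
  by exists [::]; split => //; rewrite big_nil !mul0r.
have kB : (k <= #|B|)%N by apply: leq_trans le_mB; rewrite mulSn leq_addr.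
have cB : (0 < 'C(#|B|, k))%N by rewrite bin_gt0.
pose c' : R := 'C(#|B| - k, k)%:R.
pose H T1 := F T1 + m%:R / c' * \sum_(T in draws (B :\: T1) k) F T.
have card_diff T : T \in draws B k -> #|B :\: T| = (#|B| - k)%N.
  by case/drawsP=> sTB <-; rewrite cardsD (setIidPr sTB).
(* Double counting of disjoint pairs: every [T] is disjoint from exactly [c'] of the sets [T1]. *)
have swap : \sum_(T1 in draws B k) \sum_(T in draws (B :\: T1) k) F T
            = c' * \sum_(T in draws B k) F T.
  rewrite (exchange_big_dep (mem (draws B k))) /=; last first.
    move=> T1 T _ /drawsP[sT cT]; apply/drawsP; split=> //.
    by apply: subset_trans sT (subsetDl _ _).
  rewrite mulr_sumr; apply: eq_bigr => T TB.
  rewrite sumr_const /c' -(card_diff _ TB) -cards_draws mulr_natl; congr (_ *+ _).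
  apply: eq_card => T1; rewrite unfold_in /= !inE; case/drawsP: TB => sTB ->; rewrite eqxx !subsetD sTB.
  by rewrite andbT disjoint_sym /= andbAC.
have sumH : \sum_(T1 in draws B k) H T1 <=
    #|draws B k|%:R * (m.+1%:R / 'C(#|B|, k)%:R * \sum_(T in draws B k) F T).
  rewrite big_split /= -mulr_sumr swap card_draws_in.
  set E := \sum_(T in _) _.
  have -> : 'C(#|B|, k)%:R * (m.+1%:R / 'C(#|B|, k)%:R * E) = m.+1%:R * E :> R.
    by rewrite !mulrA (mulrAC _ m.+1%:R) divff ?mul1r // pnatr_eq0 -lt0n.
  (* For [m = 0] the count [c'] may vanish, so it cannot be divided out. *)
  case: (posnP m) => [->|m0]; first by rewrite !mul0r addr0 mul1r.
  have c'0 : c' != 0.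
    rewrite pnatr_eq0 -lt0n bin_gt0 leq_subRL // (leq_trans _ le_mB) //.
    by rewrite mulSn leq_add2l leq_pmull.
  by rewrite mulrA divfK // -[m.+1]add1n natrD mulrDl mul1r.
have [|T1 T1B] := exists_le_average _ sumH; first by rewrite card_draws_in.
have cT1 := card_diff _ T1B; rewrite /H => leH.
have [|l [sl dl lB suml]] := IH (B :\: T1).
  by rewrite cT1 leq_subRL // -mulSn.
exists (T1 :: l); split => //=; first by rewrite sl.
- rewrite dl andbT; apply/allP => T /lB /drawsP[sT _].
  by move: sT; rewrite subsetD disjoint_sym => /andP[].
- move=> T; rewrite in_cons => /predU1P[->//|/lB/drawsP[sT cT]].
  by apply/drawsP; split=> //; apply: subset_trans sT (subsetDl _ _).
have cB0 : 0 < 'C(#|B|, k)%:R :> R by rewrite ltr0n.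
rewrite big_cons -ler_pdivlMr // mulrAC; apply: le_trans leH.
rewrite lerD2l; case: (posnP m) => [m0|m0].
  by move: sl; rewrite m0 !mul0r; case: (l) => //; rewrite big_nil.
have c'0 : 0 < c'.
  rewrite ltr0n bin_gt0 leq_subRL // (leq_trans _ le_mB) //.
  by rewrite mulSn leq_add2l leq_pmull.
by rewrite mulrAC ler_pdivlMr // /c' -cT1.
Qed.

(** Markov's inequality on [2 * t] disjoint draws: more than [t] members with value above
    [2 * alpha] would alone exceed the total [2 * t * alpha]. *)
Lemma disjoint_draws_select F (alpha : R) t B k :
  (forall T, 0 <= F T) -> (2 * t * k <= #|B|)%N ->
  \sum_(T in draws B k) F T <= alpha * 'C(#|B|, k)%:R ->
  exists l, [/\ size l = t, pairwise disj l, {subset l <= draws B k}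
    & forall T, T \in l -> F T <= 2 * alpha].
Proof.
move=> F0 le_tB le_alpha.
have [t0|t0] := posnP t; first by exists [::]; rewrite t0.
have [l [sl dl lB suml]] := disjoint_draws_average F le_tB.
have kB : (k <= #|B|)%N.
  by apply: leq_trans le_tB; rewrite leq_pmull // muln_gt0.
have cB0 : 0 < 'C(#|B|, k)%:R :> R by rewrite ltr0n bin_gt0.
have sumF : \sum_(T <- l) F T <= (2 * t)%:R * alpha.
  rewrite -(ler_pM2r cB0); apply: le_trans suml _.
  by rewrite -mulrA ler_wpM2l // ler0n.
pose good T := F T <= 2 * alpha.
have cnt : (t <= size (filter good l))%N.
  rewrite leqNgt; apply/negP => lt_good.
  have bad : (t < size (filter (predC good) l))%N.
    have := count_predC good l; rewrite sl !size_filter in lt_good *; lia.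
  have : (size (filter (predC good) l))%:R * (2 * alpha) < \sum_(T <- l) F T.
    rewrite (bigID good) /= ltr_wpDl ?sumr_ge0 //.
    rewrite -(big_filter l) ltNge; apply/negP => /exists_le_average_seq.
    case; first by apply: leq_trans bad.
    by move=> T; rewrite mem_filter /= => /andP[/negP nT _] /nT.
  rewrite ltNge => /negP; apply; apply: le_trans sumF _.
  have al0 : 0 <= alpha.
    rewrite -(ler_pM2r cB0) mul0r (le_trans _ le_alpha) //.
    exact: sumr_ge0.
  rewrite mulrA ler_wpM2r // -natrM ler_nat; lia.
exists (take t (filter good l)); split.
- by rewrite size_take_min (minn_idPl cnt).
- apply: (subseq_pairwise (take_subseq _ _)); exact: pairwise_filter.
- by move=> T /mem_take; rewrite mem_filter => /andP[_ /lB].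
- by move=> T /mem_take; rewrite mem_filter => /andP[].
Qed.

End Families.

(** The draws avoiding [y] are the draws from [B :\ y]; subtracting them leaves the absorption
    identity for binomials. *)
Lemma card_draws_through (V : finType) (B : {set V}) (k : nat) y :
  y \in B -> (#|[set T in draws B k | y \in T]| * #|B| = k * 'C(#|B|, k))%N.
Proof.
move=> yB; case: k => [|k].
  rewrite mul0n (_ : [set T in _ | _] = set0) ?cards0 //.
  apply/setP => T; rewrite !inE cards_eq0; apply/negP => /andP[/andP[_ /eqP ->]].
  by rewrite inE.
have /(congr1 (fun x => x * #|B|)%N) := cardsID [set T : {set V} | y \in T] (draws B k.+1).
have -> : draws B k.+1 :\: [set T : {set V} | y \in T] = draws (B :\ y) k.+1.
  by apply/setP => T; rewrite !inE subsetD1; case: (y \in T); rewrite /= ?andbF ?andbT.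
rewrite !card_draws_in (cardsD1 y B) yB add1n /= binS mulnDl addnC.
rewrite (_ : draws B k.+1 :&: _ = [set T in draws B k.+1 | y \in T]); last first.
  by apply/setP => T; rewrite !inE.
have := mul_bin_diag #|B :\ y|.+1 k; rewrite /= binS; lia.
Qed.

(** * Subsets of [A] that hit most of [B] *)

Section Covering.

Variables (R : realFieldType) (V : finType) (e : rel V).
Implicit Types (A B S T X Y : {set V}) (l lS lT : seq {set V}).

(** A subset [T] of [B] has no edge from [S] exactly when [T \subset unhit B S], so missing edges
    are counted as contained sets. *)
Definition unhit B S := [set v in B | [forall u in S, ~~ e u v]].

Definition nbrs A v := [set u in A | e u v].

Lemma unhit_sub B S : unhit B S \subset B.
Proof. by apply/subsetP => v; rewrite inE => /andP[]. Qed.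

Lemma unhit_edge B S T : T \subset B -> ~~ (T \subset unhit B S) ->
  exists x y, [/\ x \in S, y \in T & e x y].
Proof.
move=> sTB /subsetPn[y yT]; rewrite inE (subsetP sTB y yT) /= negb_forall_in.
by case/exists_inP=> x xS; rewrite negbK => exy; exists x, y.
Qed.

Lemma unhit0 B : unhit B set0 = B.
Proof.
apply/setP => v; rewrite inE; case: (v \in B) => //=.
by apply/forall_inP => u; rewrite inE.
Qed.

Lemma unhitU1 B S u : unhit B (u |: S) = unhit (unhit B S) [set u].
Proof.
apply/setP => v; rewrite !inE -andbA; congr (_ && _).
apply/forall_inP/andP => [H|[/forall_inP H1 /forall_inP H2] w].
  split; apply/forall_inP => w wS; apply: H; rewrite !inE.
    by rewrite wS orbT.
  by rewrite inE in wS; rewrite wS.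
by rewrite !inE => /predU1P[->|/H1//]; apply: H2; rewrite inE.
Qed.

Lemma sum_draws_subset B X k : X \subset B ->
  \sum_(T in draws B k) (T \subset X)%:R = 'C(#|X|, k)%:R :> R.
Proof.
move=> sXB; rewrite -card_draws_in -sum1_card natr_sum [RHS]big_mkcond [LHS]big_mkcond /=.
apply: eq_bigr => T _; rewrite !inE.
case sTX: (T \subset X) => //=; last by case: ifP.
by rewrite (subset_trans sTX sXB) /=; case: ifP.
Qed.

(** For each [S], the [k]-subsets of [B] inside its unhit set make up at most a share [rho ^+ k]. *)
Lemma sum_unhit_draws (rho : R) lS B k :
  (forall S, S \in lS -> #|unhit B S|%:R <= rho * #|B|%:R) ->
  \sum_(T in draws B k) \sum_(S <- lS) (T \subset unhit B S)%:R
    <= (size lS)%:R * rho ^+ k * 'C(#|B|, k)%:R.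
Proof.
move=> small; rewrite exchange_big /=.
under eq_bigr => S _ do rewrite (sum_draws_subset _ (unhit_sub B S)).
elim: lS small => [|S lS IH] small; first by rewrite big_nil !mul0r.
rewrite big_cons /= -add1n natrD !mulrDl mul1r lerD //.
  by apply: bin_le_exp; [exact: subset_leq_card (unhit_sub _ _) | apply: small; rewrite mem_head].
by apply: IH => S' S'l; apply: small; rewrite in_cons S'l orbT.
Qed.

(** Let [F T] count the [S] that [T] misses. Its average is below 1/2, so Markov's inequality yields
    sets with [F T < 1], which miss none. *)
Lemma hitting_family (rho : R) lS t B k :
  size lS = t -> (2 * t * k <= #|B|)%N ->
  (forall S, S \in lS -> #|unhit B S|%:R <= rho * #|B|%:R) ->
  t%:R * rho ^+ k < 2^-1 ->
  exists lT, [/\ size lT = t, pairwise (@disj V) lT, {subset lT <= draws B k}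
    & forall S T, S \in lS -> T \in lT -> ~~ (T \subset unhit B S)].
Proof.
move=> sS le_tB small lt_half.
pose F T : R := \sum_(S <- lS) (T \subset unhit B S)%:R.
have F0 T : 0 <= F T by apply: sumr_ge0 => S _; rewrite ler0n.
have := sum_unhit_draws k small; rewrite sS => le_sum.
have [lT [sT dT lTB ltF]] := disjoint_draws_select F0 le_tB le_sum.
exists lT; split => // S T Sl Tl; apply/negP => sTS.
suff : 1 <= F T.
  by move=> F1; have := ltF _ Tl; lra.
rewrite /F (big_rem S) //= sTS lerDl; apply: sumr_ge0 => ? _; exact: ler0n.
Qed.

(** A vertex of [B] is unhit by a random [s]-subset of [A] if that subset avoids its [d] or more
    neighbours, which has probability at most [(1 - d / |A|)^s]. The factor 2 is Markov's. *)
Lemma covering_draws d A B t s :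
  (forall v, v \in B -> d <= #|nbrs A v|)%N -> (2 * t * s <= #|A|)%N ->
  exists lS, [/\ size lS = t, pairwise (@disj V) lS, {subset lS <= draws A s}
    & forall S, S \in lS ->
        #|unhit B S|%:R <= 2 * (1 - d%:R / #|A|%:R) ^+ s * #|B|%:R :> R].
Proof.
move=> deg le_tA.
pose F S : R := #|unhit B S|%:R.
have F0 S : 0 <= F S by rewrite ler0n.
have [|l [sl dl lA lF]] := @disjoint_draws_select _ _ F
    ((1 - d%:R / #|A|%:R) ^+ s * #|B|%:R) t A s F0 le_tA; last first.
  by exists l; split=> // S Sl; rewrite -mulrA; apply: lF.
have -> : \sum_(S in draws A s) F S =
    \sum_(v in B) \sum_(S in draws A s) (S \subset A :\: nbrs A v)%:R.
  rewrite exchange_big /=; apply: eq_bigr => S /drawsP[sSA _].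
  rewrite /F -sum1_card natr_sum big_mkcond [RHS]big_mkcond /=; apply: eq_bigr => v _.
  rewrite inE; case: (v \in B) => //=; rewrite subsetD sSA /=.
  have -> : [forall u in S, ~~ e u v] = [disjoint S & nbrs A v].
    apply/forall_inP/pred0P => [H u|H u uS] /=.
      by rewrite !inE; apply/negP => /and3P[/H/negP].
    by move/negbT: (H u); rewrite /= uS inE (subsetP sSA u uS).
  by case: ifP.
rewrite mulrAC (_ : _ * #|B|%:R = \sum_(v in B) (1 - d%:R / #|A|%:R) ^+ s * 'C(#|A|, s)%:R); last first.
  by rewrite sumr_const mulr_natr.
apply: ler_sum => v vB; rewrite sum_draws_subset ?subsetDl //.
apply: bin_le_exp; first by rewrite subset_leq_card // subsetDl.
have sN : nbrs A v \subset A by apply/subsetP => u; rewrite inE => /andP[].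
have [A0|A0] := posnP #|A|.
  rewrite (_ : A :\: _ = set0) ?cards0; last by move/eqP: A0; rewrite cards_eq0 => /eqP ->; rewrite set0D.
  by rewrite A0 mulr0.
have A1 : #|A|%:R != 0 :> R by rewrite pnatr_eq0 -lt0n.
rewrite mulrBl mul1r divfK // cardsD (setIidPr sN) natrB ?subset_leq_card //.
by rewrite lerD2l lerN2 ler_nat deg.
Qed.

(** Each unhit vertex has at least [q * #|A|] neighbours in [A], so by averaging some [u] in [A]
    hits a share [q] of them; this is repeated [s] times. *)
Lemma greedy_cover (q d : R) A B s :
  0 <= q <= 1 -> 0 < d -> q * #|A|%:R <= d ->
  (forall v, v \in B -> d <= #|nbrs A v|%:R) ->
  exists S, [/\ S \subset A, (#|S| <= s)%N
    & #|unhit B S|%:R <= (1 - q) ^+ s * #|B|%:R].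
Proof.
move=> /andP[q0 q1] d0 le_qd deg; elim: s => [|s [S [sSA cS le_unhit]]].
  by exists set0; rewrite sub0set cards0 unhit0 expr0 mul1r.
set X := unhit B S in le_unhit.
have [X0|[v vX]] := set_0Vmem X.
  exists S; split=> //; first exact: leqW.
  by rewrite -/X X0 cards0 mulr_ge0 // ?ler0n // exprn_ge0 // subr_ge0.
have vB : v \in B by apply: (subsetP (unhit_sub B S)).
have A0 : (0 < #|A|)%N.
  rewrite lt0n; apply/negP => /eqP A0; have := deg _ vB.
  have -> : nbrs A v = set0.
    by apply/eqP; rewrite -cards_eq0 -leqn0 -A0 subset_leq_card //; apply/subsetP => u; rewrite inE => /andP[].
  by rewrite cards0 leNgt d0.
have [u uA le_u] : exists2 u, u \in A & #|unhit X [set u]|%:R <= (1 - q) * #|X|%:R.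
  apply: exists_le_average => //.
  have -> : \sum_(u in A) #|unhit X [set u]|%:R = \sum_(w in X) #|A :\: nbrs A w|%:R :> R.
    rewrite -!natr_sum; congr (_%:R).
    under eq_bigr => u _ do rewrite -sum1_card.
    under [RHS]eq_bigr => u _ do rewrite -sum1_card.
    rewrite (exchange_big_dep (mem X)) /=; last first.
      by move=> u w _; rewrite inE => /andP[].
    apply: eq_bigr => w wX; apply: eq_bigl => u.
    rewrite /= [w \in unhit _ _]inE wX in_setD [u \in nbrs _ _]inE /=.
    case: (u \in A) => //=; rewrite andbT.
    apply/forall_inP/idP => [H|H z]; first by apply: H; rewrite inE.
    by rewrite inE => /eqP ->.
  apply: (@le_trans _ _ (\sum_(w in X) (1 - q) * #|A|%:R)); last first.
    by rewrite sumr_const -mulr_natl; rewrite le_eqVlt; apply/orP; left; apply/eqP; ring.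
  apply: ler_sum => w wX.
  have sN : nbrs A w \subset A by apply/subsetP => z; rewrite inE => /andP[].
  rewrite cardsD (setIidPr sN) natrB ?subset_leq_card // mulrBl mul1r lerD2l lerN2.
  by apply: le_trans le_qd (deg _ _); apply: (subsetP (unhit_sub B S)).
exists (u |: S); split.
- by rewrite subUset sub1set uA.
- by rewrite cardsU1; case: (u \notin S); rewrite ?add0n ?add1n // leqW.
rewrite unhitU1 -/X; apply: le_trans le_u _.
by rewrite exprS -mulrA ler_wpM2l // subr_ge0.
Qed.

(** Deleting a chosen [S] from [A] lowers every degree by at most [s]; the term [N * s] pays for [N]
    deletions. *)
Lemma greedy_cover_family (q d : R) N A B s :
  0 <= q <= 1 -> q * #|A|%:R + (N * s)%:R <= d ->
  (forall v, v \in B -> d <= #|nbrs A v|%:R) ->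
  exists lS, [/\ size lS = N, pairwise (@disj V) lS,
     forall S, S \in lS -> S \subset A /\ (#|S| <= s)%N
    & forall S, S \in lS -> #|unhit B S|%:R <= (1 - q) ^+ s * #|B|%:R].
Proof.
move=> q01; elim: N A d => [|N IH] A d le_d deg; first by exists [::].
have /andP[q0 q1] := q01.
have qA0 (A' : {set V}) : 0 <= q * #|A'|%:R by rewrite mulr_ge0 // ler0n.
have [S [sSA cS leS]] : exists S, [/\ S \subset A, (#|S| <= s)%N
    & #|unhit B S|%:R <= (1 - q) ^+ s * #|B|%:R].
  have [->|s0] := posnP s.
    by exists set0; rewrite sub0set cards0 unhit0 expr0 mul1r.
  apply: (greedy_cover s q01 _ _ deg).
    apply: lt_le_trans le_d; rewrite ltr_wpDl // ltr0n muln_gt0 //.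
  by apply: le_trans le_d; rewrite lerDl ler0n.
have [||lS [sl dl lA lu]] := IH (A :\: S) (d - s%:R).
- rewrite lerBrDr; apply: le_trans le_d.
  rewrite mulSn natrD (addrC s%:R) addrA !lerD2r ler_wpM2l // ler_nat.
  by rewrite subset_leq_card // subsetDl.
- move=> v vB; rewrite lerBlDr; apply: le_trans (deg _ vB) _.
  rewrite -natrD ler_nat; apply: (@leq_trans (#|nbrs (A :\: S) v :|: S|)).
    rewrite subset_leq_card //; apply/subsetP => u; rewrite !inE => /andP[-> ->].
    by case: (u \in S).
  by rewrite cardsU (leq_trans (leq_subr _ _)) // leq_add2l.
exists (S :: lS); split=> //=; first by rewrite sl.
- rewrite dl andbT; apply/allP => S' /lA[+ _].
  by rewrite subsetD disjoint_sym => /andP[].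
- move=> S'; rewrite in_cons => /predU1P[->//|/lA[sS' ?]]; split=> //.
  exact: subset_trans sS' (subsetDl _ _).
- by move=> S'; rewrite in_cons => /predU1P[->//|/lu].
Qed.

(** Greedy choice: the at most [t * k] vertices used so far meet at most a share [t k^2 / |B|] of
    all [k]-subsets of [B], fewer than [W] contains. *)
Lemma disjoint_subfamily (W : {set {set V}}) B (k t : nat) :
  W \subset draws B k -> (t * k * k * 'C(#|B|, k) < #|W| * #|B|)%N ->
  exists lT, [/\ size lT = t, pairwise (@disj V) lT & {subset lT <= W}].
Proof.
move=> sW; elim: t => [|t IH] ltW; first by exists [::].
have [|l [sl dl lW]] := IH.
  by apply: leq_ltn_trans ltW; rewrite !leq_mul // leqnSn.
pose Y := \bigcup_(T <- l) T.
have cY : (#|Y| <= t * k)%N.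
  rewrite -sl /Y; elim: {sl dl} l lW {IH Y} => [|T l IH] lW; first by rewrite big_nil cards0.
  rewrite big_cons (leq_trans (leq_card_setU _ _)) // mulSn leq_add //.
    by have /(subsetP sW)/drawsP[_ ->] : T \in W by apply: lW; rewrite mem_head.
  by apply: IH => T' T'l; apply: lW; rewrite in_cons T'l orbT.
have sYB : Y \subset B.
  rewrite /Y bigcup_seq; apply/bigcupsP => T /lW/(subsetP sW)/drawsP[] //.
have meetY : (#|[set T in W | ~~ [disjoint T & Y]]| * #|B| <= t * k * k * 'C(#|B|, k))%N.
  apply: (@leq_trans ((\sum_(y in Y) #|[set T in draws B k | y \in T]|) * #|B|)).
    rewrite leq_mul2r; apply/orP; right.
    have : [set T in W | ~~ [disjoint T & Y]] \subset
             \bigcup_(y in Y) [set T in draws B k | y \in T].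
      apply/subsetP => T; rewrite inE => /andP[/(subsetP sW) TB /pred0Pn[y /andP[yT yY]]].
      by apply/bigcupP; exists y => //; rewrite inE TB.
    move/subset_leq_card/leq_trans; apply.
    elim/big_rec2: _ => [|y m X _ le_m]; first by rewrite cards0.
    by rewrite (leq_trans (leq_card_setU _ _)) // leq_add2l.
  rewrite big_distrl /=.
  under eq_bigr => y yY do rewrite (card_draws_through _ (subsetP sYB y yY)).
  by rewrite sum_nat_const -[X in (_ <= X)%N]mulnA leq_mul2r cY orbT.
have [T TW dT] : exists2 T, T \in W & [disjoint T & Y].
  apply/exists_inP; rewrite -[X in is_true X]negbK negb_exists_in; apply/negP => /forall_inP all_meet.
  move: meetY; rewrite (_ : [set T in W | _] = W); last first.
    by apply/setP => T; rewrite inE; case TW: (T \in W) => //=; apply: all_meet.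
  rewrite leqNgt => /negP; apply; apply: leq_ltn_trans ltW.
  by rewrite !leq_mul // leqnSn.
exists (T :: l); split=> /=; first by rewrite sl.
- rewrite dl andbT; apply/allP => T' T'l.
  apply: disjointWr dT; rewrite /Y (big_rem T') //=; exact: subsetUl.
- by move=> T'; rewrite in_cons => /predU1P[->//|/lW].
Qed.

End Covering.

(** * Selecting sets with many common partners *)

(** By averaging, some member of [s] is bad for at most a share [1 - th] of [W]; it is chosen and
    the rest of [W] is kept. The count [size s - t] in the bound on [c] keeps the average valid
    although [s] loses a member per round. *)
Lemma sequential_choice (R : realFieldType) (I : eqType) (J : finType)
    (r : rel I) (bad : J -> pred I) (c th : R) (t : nat) (s : seq I) (W : {set J}) :
  symmetric r -> 0 <= th <= 1 -> pairwise r s -> (t <= size s)%N ->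
  (forall T, T \in W -> (count (bad T) s)%:R <= c) ->
  c <= (size s - t)%:R * (1 - th) ->
  exists l, [/\ size l = t, pairwise r l, {subset l <= s}
    & th ^+ t * #|W|%:R <= #|[set T in W | ~~ has (bad T) l]|%:R].
Proof.
move=> rC /andP[th0 th1]; elim: t s W => [|t IH] s W rs le_ts few le_c.
  exists [::]; split=> //; rewrite expr0 mul1r ler_nat subset_leq_card //.
  by apply/subsetP => T; rewrite inE => ->.
have [S Ss le_S] : exists2 S, S \in s &
    #|[set T in W | bad T S]|%:R <= (1 - th) * #|W|%:R.
  apply: exists_le_average_seq; first exact: leq_trans le_ts.
  have -> : \sum_(S <- s) #|[set T in W | bad T S]|%:R
            = \sum_(T in W) (count (bad T) s)%:R :> R.
    rewrite -!natr_sum; congr (_%:R).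
    under [RHS]eq_bigr => T _ do rewrite -sum1_count.
    rewrite (exchange_big_dep predT) //=; apply: eq_bigr => S _.
    by rewrite -sum1_card; apply: eq_bigl => T; rewrite inE.
  apply: (@le_trans _ _ (\sum_(T in W) c)); first exact: ler_sum.
  rewrite sumr_const -[c *+ _]mulr_natr mulrA ler_wpM2r ?ler0n //.
  apply: le_trans le_c _; rewrite ler_wpM2r ?subr_ge0 // ler_nat; lia.
pose W' := [set T in W | ~~ bad T S].
have leW' : th * #|W|%:R <= #|W'|%:R.
  have : (#|W|%:R = #|[set T in W | bad T S]|%:R + #|W'|%:R :> R).
    rewrite -natrD; congr (_%:R).
    rewrite -(cardsID [set T | bad T S] W) /W'.
    by congr addn; apply: eq_card => T; rewrite !inE // andbC.
  move: le_S; lra.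
case/splitPr: Ss rs le_ts few le_c => s1 s2.
rewrite pairwise_cat allrel_consr pairwise_cons => /and3P[/andP[r1 r12] p1 /andP[r2 p2]] le_ts few le_c.
have [||||l [sl rl ls le_l]] := IH (s1 ++ s2) W'.
- by rewrite pairwise_cat r12 p1.
- by move: le_ts; rewrite !size_cat /= addnS ltnS.
- move=> T; rewrite inE => /andP[TW _]; apply: le_trans (few _ TW).
  by rewrite !count_cat /= ler_nat leq_add2l leq_addl.
- by move: le_c; rewrite !size_cat /= addnS subSS.
exists (S :: l); split=> /=; first by rewrite sl.
- rewrite rl andbT; apply/allP => S' /ls; rewrite mem_cat => /orP[/(allP r1)|/(allP r2)//].
  by rewrite rC.
- move=> S'; rewrite in_cons => /predU1P[->|/ls]; rewrite !mem_cat in_cons ?eqxx ?orbT //.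
  by case/orP => ->; rewrite ?orbT.
apply: (@le_trans _ _ (th ^+ t * #|W'|%:R)).
  by rewrite exprSr -mulrA ler_wpM2l // exprn_ge0.
apply: le_trans le_l _; rewrite ler_nat subset_leq_card //; apply/subsetP => T.
by rewrite !inE negb_or => /andP[/andP[-> ->] ->].
Qed.

Lemma exists_draw (V : finType) (A : {set V}) k :
  (k <= #|A|)%N -> exists2 T : {set V}, T \subset A & #|T| = k.
Proof.
by rewrite -bin_gt0 -card_draws_in => /card_gt0P[T /drawsP[]]; exists T.
Qed.

(** * Covering with bounded degree mass *)

Section SparseCovering.

Variables (R : realFieldType) (V : finType).
Implicit Types (e : rel V) (A B S T : {set V}).

(** Neighbourhoods seen from the [A] side, kept apart from [nbrs] because the trimmed relation [e']
    of [sparse_cover] need not be symmetric. *)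
Definition fnbrs e B u := [set v in B | e u v].

Definition cov e B S := \bigcup_(u in S) fnbrs e B u.

Lemma card_cov e B S : (#|cov e B S| + #|unhit e B S| = #|B|)%N.
Proof.
rewrite -(cardsID (unhit e B S) B) (setIidPr (unhit_sub e B S)) addnC; congr addn.
apply: eq_card => v; rewrite in_setD.
apply/bigcupP/andP => [[u uS]|[]]; rewrite !inE.
  move=> /andP[vB euv]; split=> //; rewrite vB /= negb_forall_in.
  by apply/exists_inP; exists u; rewrite ?negbK.
move=> + vB; rewrite vB negb_forall_in => /exists_inP[u uS]; rewrite negbK => euv.
by exists u; rewrite // inE vB.
Qed.

Lemma sum_fnbrs e A B :
  (\sum_(u in A) #|fnbrs e B u| = \sum_(v in B) #|nbrs e A v|)%N.
Proof.
under eq_bigr => u _ do rewrite -sum1_card.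
under [RHS]eq_bigr => u _ do rewrite -sum1_card.
rewrite (exchange_big_dep (mem B)) /=; last by move=> u v _; rewrite inE => /andP[].
by apply: eq_bigr => v vB; apply: eq_bigl => u; rewrite !inE vB.
Qed.

(* A vertex of large degree is taken alone; otherwise [S] grows while every new
   vertex brings at least half of its neighbours, so that the degree mass used
   up by [S] stays below [#|B|].  If this gets stuck, most of the degree mass
   is concentrated on the few vertices already covered. *)
Lemma sparse_cover_one e A B (d s : nat) (y : R) :
  0 < y -> 4 * y <= #|B|%:R -> (0 < s)%N ->
  (forall v, v \in B -> #|nbrs e A v| <= d)%N ->
  2 * #|A|%:R * y / s%:R + 2 * d%:R * y < (\sum_(u in A) #|fnbrs e B u|)%N%:R ->
  exists S, [/\ S \subset A, (#|S| <= s)%N, y <= #|cov e B S|%:R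
    & (\sum_(u in S) #|fnbrs e B u| <= #|B|)%N].
Proof.
move=> y0 y4 s0 deg mass.
have [/exists_inP[u uA big_u]|/exists_inPn small] :=
    boolP [exists u in A, y <= #|fnbrs e B u|%:R].
  exists [set u]; rewrite sub1set uA cards1 s0 /cov !big_set1 big_u; split=> //.
  by apply: subset_leq_card; apply/subsetP => v; rewrite inE => /andP[].
have {}small u : u \in A -> #|fnbrs e B u|%:R < y by move/small; rewrite ltNge.
(* Invariants of the growing [S]: its mass is at most twice its coverage, its size at most [s / y]
   times its coverage, and the coverage is still below [y]. *)
pose P S := [&& S \subset A, (\sum_(u in S) #|fnbrs e B u| <= 2 * #|cov e B S|)%N,
  #|S|%:R * y <= s%:R * #|cov e B S|%:R & #|cov e B S|%:R < y].
have [|S maxS] := @ex_maxset _ P.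
  by exists set0; rewrite /P sub0set /cov !big_set0 !cards0 mul0r mulr0 lexx y0.
have /and4P[sSA massS growS lt_y] := maxsetp maxS.
set C := cov e B S in massS growS lt_y.
have sR : 0 < s%:R :> R by rewrite ltr0n.
(* A vertex with more than [2 * y / s] neighbours, over half of them new, preserves the mass and
   size invariants, so by maximality it lifts the coverage to at least [y]. *)
have [/exists_inP[u uA /andP[u1 u2]]|/exists_inPn stuck] :=
    boolP [exists u in A, (2 * y < s%:R * #|fnbrs e B u|%:R) &&
                          (2 * #|fnbrs e B u :&: C| < #|fnbrs e B u|)%N].
  have uS : u \notin S.
    apply/negP => uS; move: u2; rewrite (setIidPl _) ?ltnNge ?leq_pmull //.
    exact: (bigcup_sup u).
  have covU : cov e B (u |: S) = fnbrs e B u :|: C by rewrite /cov big_setU1.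
  have cU := cardsU (fnbrs e B u) C.
  have leI : (#|fnbrs e B u :&: C| <= #|C|)%N by rewrite subset_leq_card // subsetIr.
  have c1 : (#|fnbrs e B u| + 2 * #|C| <= 2 * #|cov e B (u |: S)|)%N by rewrite covU; move: u2 cU leI; clear; lia.
  have c2 : (#|cov e B (u |: S)| <= #|fnbrs e B u| + #|C|)%N by rewrite covU; move: u2 cU leI; clear; lia.
  have massU : (\sum_(w in u |: S) #|fnbrs e B w| <= 2 * #|cov e B (u |: S)|)%N.
    by rewrite big_setU1 //=; move: massS c1; clear; lia.
  have sU : u |: S \subset A by rewrite subUset sub1set uA.
  have c1R : #|fnbrs e B u|%:R + 2 * #|C|%:R <= 2 * #|cov e B (u |: S)|%:R :> R.
    by rewrite -!natrM -natrD ler_nat.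
  have c2R : #|cov e B (u |: S)|%:R <= #|fnbrs e B u|%:R + #|C|%:R :> R.
    by rewrite -natrD ler_nat.
  have growU : #|u |: S|%:R * y <= s%:R * #|cov e B (u |: S)|%:R.
    rewrite cardsU1 uS natrD mulrDl mul1r.
    have := ler_wpM2l (ltW sR) c1R; lra.
  have reach : y <= #|cov e B (u |: S)|%:R.
    rewrite leNgt; apply/negP => ltU.
    have PU : P (u |: S) by rewrite /P sU massU growU.
    have := maxsetsup maxS PU (subsetUr _ _) => /setP/(_ u).
    by rewrite setU11 (negbTE uS).
  (* Coverage below [y] forces [#|S| < s]. The new coverage is below [2 * y], so the new mass is
     below [4 * y <= #|B|]. *)
  exists (u |: S); split=> //.
    rewrite cardsU1 uS add1n -(ltr_nat R) -(ltr_pM2r y0).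
    by apply: le_lt_trans growS _; rewrite ltr_pM2l.
  rewrite -(ler_nat R); apply: le_trans y4.
  move: massU; rewrite -(ler_nat R) => /le_trans; apply; rewrite natrM.
  have := small _ uA; lra.
(* When stuck, each [u] has at most [2 * y / s] neighbours or at least half of them in [C]; summing
   over [A] contradicts [mass]. *)
exfalso; move: mass; rewrite ltNge => /negP; apply.
rewrite natr_sum.
apply: (@le_trans _ _ (\sum_(u in A) (2 * y / s%:R + 2 * #|fnbrs e B u :&: C|%:R))).
  apply: ler_sum => u /stuck; rewrite negb_and -leNgt -leqNgt => /orP[le1|le2].
    apply: (@le_trans _ _ (2 * y / s%:R)); last by rewrite lerDl mulr_ge0 ?ler0n.
    by rewrite ler_pdivlMr // mulrC.
  apply: (@le_trans _ _ (2 * #|fnbrs e B u :&: C|%:R)); first by rewrite -natrM ler_nat.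
  by rewrite lerDr divr_ge0 ?ler0n // mulr_ge0 ?ler0n // ltW.
rewrite big_split /= sumr_const -[_ *+ _]mulr_natr -mulr_sumr -natr_sum.
have -> : 2 * y / s%:R * #|A|%:R = 2 * #|A|%:R * y / s%:R by ring.
rewrite lerD2l -mulrA ler_pM2l ?ltr0n //.
have sCB : C \subset B.
  by apply/bigcupsP => u _; apply/subsetP => v; rewrite inE => /andP[].
have -> : (\sum_(u in A) #|fnbrs e B u :&: C| = \sum_(v in C) #|nbrs e A v|)%N.
  rewrite -sum_fnbrs; apply: eq_bigr => u _; apply: eq_card => v.
  rewrite in_setI [v \in fnbrs _ B _]inE [in RHS]inE andbC; case vC: (v \in C) => //=.
  by rewrite (subsetP sCB v vC).
apply: (@le_trans _ _ (#|C| * d)%N%:R).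
  rewrite ler_nat -sum_nat_const; apply: leq_sum => v vC.
  by apply: deg; apply: (subsetP sCB).
by rewrite natrM mulrC ler_wpM2l ?ler0n // ltW.
Qed.

(** Each removed [S] takes mass at most [#|B|], paid for by the term [t%:R * #|B|%:R]; the upper
    bounds on [#|A|] and on degrees survive the removal. *)
Lemma sparse_cover_family e A B (a d s t : nat) (y : R) :
  0 < y -> 4 * y <= #|B|%:R -> (0 < s)%N -> (#|A| <= a)%N ->
  (forall v, v \in B -> #|nbrs e A v| <= d)%N ->
  2 * a%:R * y / s%:R + 2 * d%:R * y + t%:R * #|B|%:R
    < (\sum_(u in A) #|fnbrs e B u|)%N%:R ->
  exists lS, [/\ size lS = t, pairwise (@disj V) lS,
     forall S, S \in lS -> S \subset A /\ (#|S| <= s)%N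
    & forall S, S \in lS -> y <= #|cov e B S|%:R].
Proof.
move=> y0 y4 s0; elim: t A => [|t IH] A le_a deg mass; first by exists [::].
have sR : 0 < s%:R :> R by rewrite ltr0n.
have [|S [sSA cS covS massS]] := sparse_cover_one y0 y4 s0 deg.
  apply: le_lt_trans mass; rewrite ler_wpDr ?mulr_ge0 ?ler0n // lerD2r.
  rewrite ler_pM2r ?invr_gt0 // ler_pM2r // ler_pM2l ?ltr0n // ler_nat //.
have sDA : A :\: S \subset A by apply: subsetDl.
have [|||lS [sl dl lA lc]] := IH (A :\: S).
- exact: leq_trans (subset_leq_card sDA) le_a.
- move=> v vB; apply: leq_trans (deg _ vB); apply: subset_leq_card.
  by apply/subsetP => u; rewrite !inE => /andP[/andP[_ ->]].
- move: mass; rewrite (big_setID S) /= (setIidPr sSA) natrD.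
  move: massS; rewrite -(ler_nat R) -[t.+1]add1n natrD mulrDl mul1r; lra.
exists (S :: lS); split=> //=; first by rewrite sl.
- rewrite dl andbT; apply/allP => S' /lA[+ _].
  by rewrite subsetD disjoint_sym => /andP[].
- move=> S'; rewrite in_cons => /predU1P[->//|/lA[sS' ?]]; split=> //.
  exact: subset_trans sS' sDA.
- by move=> S'; rewrite in_cons => /predU1P[->//|/lc].
Qed.

(** Each vertex of [B] is trimmed to exactly [d] neighbours, so the mass equals [d * #|B|]; with
    [y = eps * #|B|] the numeric hypothesis is the mass condition divided by [#|B|]. *)
Lemma sparse_cover e A B (d s t : nat) (eps : R) :
  0 < eps <= 4^-1 -> (0 < s)%N -> (0 < #|B|)%N ->
  (forall v, v \in B -> d <= #|nbrs e A v|)%N ->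
  2 * #|A|%:R * eps / s%:R + 2 * d%:R * eps + t%:R < d%:R ->
  exists lS, [/\ size lS = t, pairwise (@disj V) lS,
     forall S, S \in lS -> S \subset A /\ (#|S| <= s)%N
    & forall S, S \in lS -> #|unhit e B S|%:R <= (1 - eps) * #|B|%:R].
Proof.
move=> /andP[eps0 eps4] s0 B0 deg lt_d.
have BR : 0 < #|B|%:R :> R by rewrite ltr0n.
(* The default [set0] is never reached for [v] in [B], which has at least [d] neighbours. *)
pose E v := odflt set0 [pick T in draws (nbrs e A v) d].
have EP v : v \in B -> E v \subset nbrs e A v /\ #|E v| = d.
  move=> vB; rewrite /E; case: pickP => [T /drawsP//|no].
  have [T sT cT] := exists_draw (deg v vB).
  by have := no T; rewrite !inE sT cT eqxx.
pose e' := [rel u v | u \in E v].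
have nbrs_e' v : v \in B -> nbrs e' A v = E v.
  move=> /EP[sE _]; apply/setP => u; rewrite !inE /=.
  by case uE: (u \in E v); rewrite ?andbF // andbT; have := subsetP sE u uE; rewrite inE => /andP[].
have [|||||lS [sl dl lA lc]] := @sparse_cover_family e' A B #|A| d s t (eps * #|B|%:R) _ _ s0.
- by rewrite mulr_gt0.
- by rewrite mulrA ler_piMl ?ler0n //; lra.
- by [].
- by move=> v vB; rewrite nbrs_e' //; have [_ ->] := EP _ vB.
- rewrite sum_fnbrs (eq_bigr (fun=> d)); last by move=> v vB; rewrite nbrs_e' //; have [] := EP _ vB.
  rewrite sum_nat_const natrM.
  move: lt_d; rewrite -(ltr_pM2r BR) [X in _ < X]mulrC => /le_lt_trans; apply.
  by rewrite le_eqVlt; apply/orP; left; apply/eqP; ring.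
exists lS; split=> // S Sl; have := lc _ Sl; have [sSA _] := lA _ Sl.
have /(congr1 (fun k : nat => k%:R : R)) := card_cov e' B S; rewrite natrD /=.
suff : #|unhit e B S|%:R <= #|unhit e' B S|%:R :> R by lra.
rewrite ler_nat subset_leq_card //; apply/subsetP => v; rewrite !inE => /andP[vB /forall_inP H].
rewrite vB; apply/forall_inP => u uS; apply: contra (H u uS) => /= uE.
by have [/subsetP/(_ u uE) + _] := EP _ vB; rewrite inE => /andP[].
Qed.

End SparseCovering.

(** * Bi-complete pairs of families from a minimum degree *)

(** The scheme shared by cases (1) and (2): [rho] bounds the average share of the [N] greedy sets
    missed by an [r]-subset of [B], [kap] is the Markov threshold for that share, and [th] is the
    share of [r]-subsets kept at each of the [t] selections. *)
Lemma bicomplete_pairs_of_dense (R : realFieldType) (V : finType) (e : rel V)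
    (q d rho kap th : R) (N t r : nat) (A B : {set V}) :
  0 <= q <= 1 -> q * #|A|%:R + (N * r)%:R <= d ->
  (forall v, v \in B -> d <= #|nbrs e A v|%:R) ->
  (1 - q) ^+ (r * r) <= rho -> 0 < kap -> 0 <= th <= 1 -> (t <= N)%N ->
  kap * N%:R <= (N - t)%:R * (1 - th) ->
  (t * r * r)%:R < (1 - rho / kap) * th ^+ t * #|B|%:R ->
  exists lS lT, [/\ size lS = t /\ size lT = t,
    pairwise (@disj V) lS /\ pairwise (@disj V) lT,
    (forall S, S \in lS -> S \subset A /\ (#|S| <= r)%N),
    (forall T, T \in lT -> T \subset B /\ (#|T| <= r)%N)
    & forall S T, S \in lS -> T \in lT -> ~~ (T \subset unhit e B S)].
Proof.
move=> q01 le_d deg le_rho kap0 th01 le_tN le_kap room.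
have [t0|t0] := posnP t; first by exists [::], [::]; rewrite t0.
have N0 : 0 < N%:R :> R by rewrite ltr0n (leq_trans t0).
have [l0 [s0 d0 l0A l0u]] := greedy_cover_family q01 le_d deg.
have := sum_unhit_draws r l0u; rewrite -exprM s0 => le_sum.
pose bad (T S : {set V}) := T \subset unhit e B S.
(* By Markov's inequality at least a share [1 - rho / kap] of the draws miss at most [kap * N]
   greedy sets. *)
pose W0 := [set T in draws B r | (count (bad T) l0)%:R <= kap * N%:R].
set C := 'C(#|B|, r) in le_sum.
have leW0 : (1 - rho / kap) * C%:R <= #|W0|%:R.
  have : #|draws B r :\: W0|%:R * (kap * N%:R) <= N%:R * rho * C%:R.
    apply: (@le_trans _ _ (N%:R * (1 - q) ^+ (r * r) * C%:R)); last first.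
      by rewrite ler_wpM2r ?ler0n // ler_wpM2l // ltW.
    apply: le_trans le_sum.
    rewrite mulr_natl -sumr_const [X in _ <= X](bigID (mem (draws B r :\: W0))) /=.
    apply: ler_wpDr; first by apply: sumr_ge0 => T _; apply: sumr_ge0 => S _; rewrite ler0n.
    rewrite [X in _ <= X](eq_bigl (mem (draws B r :\: W0))); last first.
      by move=> T /=; rewrite !inE; case: (_ && (_ == _)); rewrite /= ?andbF ?andbT.
    apply: ler_sum => T; rewrite in_setD inE => /andP[+ TB].
    rewrite TB /= -ltNge => /ltW/le_trans; apply.
    by rewrite -sum1_count natr_sum big_mkcond /=; apply: ler_sum => S _; rewrite /bad; case: ifP.
  have -> : #|draws B r :\: W0|%:R = C%:R - #|W0|%:R :> R.
    have sW0 : W0 \subset draws B r by apply/subsetP => T; rewrite inE => /andP[].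
    by rewrite cardsD (setIidPr sW0) natrB ?subset_leq_card // card_draws_in.
  rewrite mulrA (mulrC _ N%:R) -mulrA ler_pM2l // -ler_pdivlMr // mulrBl mul1r.
  have -> : rho / kap * C%:R = rho * C%:R / kap by ring.
  by move: (rho * _ / _) => z; lra.
have few T : T \in W0 -> (count (bad T) l0)%:R <= kap * N%:R by rewrite inE => /andP[].
have [|||lS [sS dS lS0 leW]] := @sequential_choice R _ _ (@disj V) bad _ th t l0 W0 _ th01 d0 _ few.
- by move=> S T; rewrite /disj disjoint_sym.
- by rewrite s0.
- by rewrite s0.
set W := [set T in W0 | _] in leW.
have sW : W \subset draws B r by apply/subsetP => T; rewrite !inE => /andP[/andP[]].
have [|lT [sT dT lTW]] := disjoint_subfamily (t := t) sW.
  have /andP[th0 _] := th01.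
  have B0 : 0 < #|B|%:R :> R.
    rewrite ltr0n lt0n; apply/negP => /eqP B0; move: room; rewrite B0 mulr0.
    by rewrite ltNge ler0n.
  (* If [r] exceeded [#|B|], the right side of [room] would be at most [#|B| < r], but its left side
     is at least [r]. *)
  have C0 : 0 < C%:R :> R.
    rewrite ltr0n bin_gt0 leqNgt; apply/negP => ltr.
    have C0 : C = 0%N by rewrite /C bin_small.
    have W00 : #|W0|%:R = 0 :> R.
      apply/eqP; rewrite pnatr_eq0 -leqn0 -C0 /C -card_draws_in subset_leq_card //.
      by apply/subsetP => T; rewrite inE => /andP[].
    move: room; apply/negP; rewrite -leNgt.
    have rho0 : 0 <= rho.
      by apply: le_trans le_rho; rewrite exprn_ge0 // subr_ge0; case/andP: q01.
    apply: (@le_trans _ _ (1 * 1 * #|B|%:R)).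
      rewrite ler_wpM2r ?ler0n //.
      have thX : th ^+ t <= 1 by apply: exprn_ile1; case/andP: th01.
      have thX0 : 0 <= th ^+ t by apply: exprn_ge0.
      have z1 : 1 - rho / kap <= 1 by rewrite gerBl divr_ge0 // ltW.
      have := ler_wpM2r thX0 z1; lra.
    rewrite !mul1r ler_nat (leq_trans (ltnW ltr)) // leq_pmull //.
    by rewrite muln_gt0 t0 (leq_trans _ ltr).
  rewrite -(ltr_nat R) !natrM.
  apply: (@lt_le_trans _ _ ((1 - rho / kap) * th ^+ t * #|B|%:R * C%:R)).
    by rewrite ltr_pM2r // -!natrM.
  rewrite mulrAC ler_pM2r //; apply: le_trans leW.
  by rewrite mulrAC mulrC ler_wpM2l // exprn_ge0.
exists lS, lT; split=> // [S /lS0/l0A //|T /lTW/(subsetP sW)/drawsP[? ->]//|S T Sl /lTW].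
by rewrite inE => /andP[_ /hasPn/(_ S Sl)].
Qed.

(** * Enlarging the sets to size exactly [r] *)

Lemma disjoint_setUr (V : finType) (S Y Z : {set V}) :
  [disjoint S & Y :|: Z] = [disjoint S & Y] && [disjoint S & Z].
Proof. by rewrite -!setI_eq0 setIUr setU_eq0. Qed.

Lemma exists_between (V : finType) (S F : {set V}) r :
  S \subset F -> (#|S| <= r <= #|F|)%N ->
  exists T : {set V}, [/\ S \subset T, T \subset F & #|T| = r].
Proof.
move=> sSF /andP[le_S le_F]; have [|X sX cX] := @exists_draw _ (F :\: S) (r - #|S|).
  by rewrite cardsD (setIidPr sSF) leq_sub2r.
move: sX; rewrite subsetD => /andP[sXF dX].
exists (S :|: X); split; [exact: subsetUl | by rewrite subUset sSF |].
by rewrite cardsU (setIC S) (disjoint_setI0 dX) cards0 subn0 cX subnKC.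
Qed.

(** Sets are enlarged one by one, avoiding [Y] and the sets still to come; each enlarged set then
    joins [Y]. The order is kept, so an index still tells the original family. *)
Lemma extend_family (V : finType) (r : nat) (l : seq {set V}) (Y : {set V}) :
  pairwise (@disj V) l ->
  (forall S, S \in l -> (#|S| <= r)%N /\ [disjoint S & Y]) ->
  (#|Y| + size l * r <= #|V|)%N ->
  exists l', [/\ size l' = size l, pairwise (@disj V) l',
    (forall T, T \in l' -> #|T| = r /\ [disjoint T & Y])
    & forall i, nth set0 l i \subset nth set0 l' i].
Proof.
elim: l Y => [|S l IH] Y; first by exists [::].
rewrite pairwise_cons => /andP[dSl dl] ok le_n.
pose Z := \bigcup_(T in l) T.
have cZ : (#|Z| <= size l * r)%N.
  rewrite /Z -bigcup_seq; have {}ok T : T \in l -> (#|T| <= r)%N.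
    by move=> Tl; case: (ok T) => //; rewrite in_cons Tl orbT.
  elim: (l) ok => [|T m IHm] ok; first by rewrite big_nil cards0.
  rewrite big_cons (leq_trans (leq_card_setU _ _)) // mulSn leq_add ?ok ?mem_head //.
  by apply: IHm => T' T'm; rewrite ok // in_cons T'm orbT.
have [cS dSY] : (#|S| <= r)%N /\ [disjoint S & Y] by apply: ok; rewrite mem_head.
have [||T [sST sT cT]] := @exists_between _ S (~: (Y :|: Z)) r.
- rewrite -disjoints_subset disjoint_setUr dSY /=.
  by apply/bigcup_disjointP => T Tl; exact: (allP dSl).
- rewrite cS /= -(leq_add2l #|Y :|: Z|) cardsC.
  apply: leq_trans le_n; rewrite cardsU /= mulSn addnA addnAC leq_add2r.
  by rewrite (leq_trans (leq_subr _ _)) // leq_add2l.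
move: sT; rewrite -disjoints_subset disjoint_sym => dT.
have dTY : [disjoint T & Y] by rewrite disjoint_sym; apply: disjointWl dT; apply: subsetUl.
have [|||l' [sl' dl' ok' nth']] := IH (Y :|: T).
- by [].
- move=> S' S'l; have [|cS' dS'] := ok S'; first by rewrite in_cons S'l orbT.
  split=> //; rewrite disjoint_setUr dS' /=; apply: disjointWl dT.
  apply: subset_trans (subsetUr _ _); exact: bigcup_sup.
- apply: leq_trans le_n; rewrite cardsU /= mulSn addnA leq_add2r.
  by rewrite (leq_trans (leq_subr _ _)) // leq_add2l cT.
exists (T :: l'); split=> /=; first by rewrite sl'.
- rewrite dl' andbT; apply/allP => T' /ok'[_]; rewrite /disj disjoint_sym.
  by apply: disjointWl; apply: subsetUr.
- move=> T'; rewrite in_cons => /predU1P[->//|/ok'[-> dT']]; split=> //.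
  by apply: disjointWr dT'; apply: subsetUl.
- by case.
Qed.

Lemma bicomplete_of_families (G : sgraph) (A B : {set G}) (r t : nat) lS lT :
  [disjoint A & B] -> (2 * r * t <= #|G|)%N -> size lS = t -> size lT = t ->
  pairwise (@disj G) lS -> pairwise (@disj G) lT ->
  (forall S, S \in lS -> S \subset A /\ (#|S| <= r)%N) ->
  (forall T, T \in lT -> T \subset B /\ (#|T| <= r)%N) ->
  (forall S T, S \in lS -> T \in lT -> ~~ (T \subset unhit (@adj G) B S)) ->
  has_weakly_bicomplete G r t.
Proof.
move=> dAB le_n sS sT dS dT okS okT hit.
(* Both families are enlarged together, possibly beyond [A] and [B], so that all [2 * t] sets stay
   disjoint. *)
have [|||l [sl dl okl sub]] := @extend_family G r (lS ++ lT) set0.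
- rewrite pairwise_cat dS dT !andbT; apply/allrelP => S T /okS[sSA _] /okT[sTB _].
  exact: disjointW sSA sTB dAB.
- move=> S; rewrite mem_cat => /orP[/okS[_ ?]|/okT[_ ?]]; split=> //;
    by rewrite disjoint_sym disjoints_subset sub0set.
- by rewrite cards0 size_cat sS sT; lia.
rewrite size_cat sS sT in sl.
have ltS (i : 'I_t) : (i < t + t)%N by apply: ltn_addr.
have ltT (i : 'I_t) : (t + i < t + t)%N by rewrite ltn_add2l.
have card_nth i : (i < t + t)%N -> #|nth set0 l i| = r.
  by move=> lti; case: (okl (nth set0 l i)) => //; rewrite mem_nth ?sl.
have disj_nth i j : (i < t + t)%N -> (j < t + t)%N -> i != j ->
    [disjoint nth set0 l i & nth set0 l j].
  move=> lti ltj; have /pairwiseP H := dl.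
  rewrite neq_ltn => /orP[lt|lt]; last rewrite disjoint_sym.
    by apply: (H set0) => //; rewrite inE sl.
  by apply: (H set0) => //; rewrite inE sl.
exists (fun i => nth set0 l i), (fun i => nth set0 l (t + i)); split.
- by move=> i; rewrite !card_nth.
- by move=> i j ij; rewrite !disj_nth // eqn_add2l.
- by move=> i j; rewrite disj_nth // neq_ltn ltn_addr.
move=> i j; have := sub i; have := sub (t + j)%N.
rewrite !nth_cat sS ltn_ord ltnNge leq_addr /= addKn => subT subS.
have Si : nth set0 lS i \in lS by rewrite mem_nth // sS.
have Tj : nth set0 lT j \in lT by rewrite mem_nth // sT.
have [sTB _] := okT _ Tj.
have [x [y [xS yT exy]]] := unhit_edge sTB (hit _ _ Si Tj).
by exists x, y; rewrite (subsetP subS) ?(subsetP subT).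
Qed.

Lemma complete_of_bicomplete (G : sgraph) (r t : nat) :
  has_weakly_bicomplete G r t -> has_weakly_complete G (2 * r) t.
Proof.
case=> S [T [cST dST dSTij eST]]; exists (fun i => S i :|: T i); split.
- move=> i; have [cS cT] := cST i.
  by rewrite cardsU disjoint_setI0 // cards0 subn0 cS cT mul2n addnn.
- move=> i j ij; have [dS dT] := dST _ _ ij.
  rewrite -setI_eq0 setIUl !setIUr !setU_eq0 !setI_eq0 dS dT dSTij /=.
  by rewrite disjoint_sym dSTij.
- move=> i j _; have [x [y [xS yT exy]]] := eST i j.
  by exists x, y; rewrite !inE xS yT orbT.
Qed.

(** * Balanced cuts and vertices of large degree *)

Lemma nat_ceil (R : realType) (x : R) : 0 <= x ->
  exists d : nat, [/\ x <= d%:R, d%:R < x + 1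
    & forall m : nat, x <= m%:R -> (d <= m)%N].
Proof.
move=> x0; have [c c0] : exists c : nat, Num.ceil x = c%:Z.
  have : 0 <= Num.ceil x by rewrite ceil_ge0 (lt_le_trans _ x0) // ltrN10.
  by case: (Num.ceil x) => // c _; exists c.
have := ceil_itv x; rewrite c0 => /andP[lt1 le1].
have lt2 : c%:R - 1 < x by move: lt1; rewrite rmorphB.
exists c; split=> [//||m le_m]; first by rewrite -ltrBlDr.
by rewrite -ltnS -(ltr_nat R) -addn1 natrD -ltrBlDr (lt_le_trans lt2).
Qed.

Lemma sqr_le_halves m : (m ^ 2 <= (4 * (m./2 * (m - m./2))).+1)%N.
Proof.
have E : m = (odd m + m./2 + m./2)%N by have := odd_double_half m; lia.
have -> : (m - m./2 = odd m + m./2)%N by lia.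
by rewrite {1}E; case: (odd m); move: m./2 => k {E}; rewrite -mulnn; lia.
Qed.

Section Bisection.

Variables (R : realType) (G : sgraph).
Implicit Types (U : {set G}).

Lemma edge_density_le1 : edge_density R G <= 1.
Proof.
rewrite /edge_density; have [->|C0] := posnP 'C(#|G|, 2); first by rewrite invr0 mulr0.
rewrite ler_pdivrMr ?ltr0n // mul1r ler_nat -card_draws subset_leq_card //.
apply/subsetP => E /imset2P[x y _]; rewrite !inE /= => exy ->.
by rewrite cards2 (contraTneq _ exy) // => ->; rewrite adj_irrefl.
Qed.

Lemma edge_density_ge0 : 0 <= edge_density R G.
Proof. by rewrite divr_ge0 ?ler0n. Qed.

Definition adj_pairs := [set xy : G * G | adj xy.1 xy.2].

Lemma edges_le_adj_pairs : (2 * #|edges G| <= #|adj_pairs|)%N.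
Proof.
rewrite mulnC -sum_nat_const -sum1_card.
rewrite (partition_big (fun xy : G * G => [set xy.1; xy.2]) (mem (edges G))) /=; last first.
  move=> [x y]; rewrite inE /= => exy; apply/imset2P.
  by exists x y => //; rewrite !inE exy.
apply: leq_sum => E /imset2P[x y _]; rewrite !inE /= => exy ->.
have nxy : x != y by apply: contraTneq exy => ->; rewrite adj_irrefl.
rewrite sum1_card -(_ : #|[set (x, y); (y, x)]| = 2%N); last first.
  by rewrite cards2 xpair_eqE negb_and nxy.
apply: subset_leq_card; apply/subsetP => z; rewrite !inE => /orP[]/eqP ->; rewrite unfold_in /= inE /=.
  by rewrite exy eqxx.
by rewrite adj_sym exy setUC eqxx.
Qed.

(** A random [h]-set contains [x] but not [y] with probability [h (n - h) / (n (n - 1))], here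
    cleared of denominators. Such sets are the [h]-subsets of [[set~ y]] through [x]. *)
Lemma card_splitting h (x y : G) : x != y ->
  (#|[set U in draws setT h | (x \in U) && (y \notin U)]| * (#|G| * #|G|.-1)
   = h * (#|G| - h) * 'C(#|G|, h))%N.
Proof.
move=> nxy; have xy : x \in [set~ y] by rewrite !inE.
have := card_draws_through h xy; rewrite cardsC1 => thr.
have -> : [set U in draws setT h | (x \in U) && (y \notin U)] =
    [set U in draws [set~ y] h | x \in U].
  apply/setP => U; rewrite !inE subsetT -[U \subset [set~ y]]disjoints_subset.
  rewrite disjoint_sym disjoints1 /=; case: (x \in U) => /=; rewrite ?andbF ?andbT //.
  by rewrite andbC.
rewrite mulnCA thr mulnCA -mulnA; congr muln; exact: mul_bin_down.
Qed.

(** The cut is averaged over all sets of size [n./2]; there are at least [p n (n - 1)] ordered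
    adjacent pairs, each split as in [card_splitting]. *)
Lemma exists_bisection : (1 < #|G|)%N ->
  exists2 U : {set G}, #|U| = (#|G|)./2 &
    edge_density R G * ((#|G|)./2 * (#|G| - (#|G|)./2))%N%:R
      <= (\sum_(v in ~: U) #|nbrs (@adj G) U v|)%N%:R.
Proof.
move=> n1; set n := #|G| in n1 *; set h := n./2; set p := edge_density R G.
pose cut (U : {set G}) := (\sum_(v in ~: U) #|nbrs (@adj G) U v|)%N.
have nn0 : (0 < n * n.-1)%N by rewrite muln_gt0 !lt0n; case: (n) n1 => [|[]].
have hn : (h <= n)%N by rewrite /h; lia.
have cutE U : cut U = (\sum_(xy in adj_pairs) ((xy.1 \in U) && (xy.2 \notin U)))%N.
  rewrite /cut; under eq_bigr => v _ do rewrite -sum1_card.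
  rewrite pair_big_dep /= [RHS]big_mkcond [LHS]big_mkcond /=.
  rewrite (reindex_inj (h := fun xy : G * G => (xy.2, xy.1))) /=; last first.
    by move=> [a b] [c d] [-> ->].
  by apply: eq_bigr => -[x y] _; rewrite !inE /=; case: (adj x y); case: (x \in U); case: (y \in U).
have sum_cut : (\sum_(U in draws setT h) cut U * (n * n.-1)
    = #|adj_pairs| * (h * (n - h) * 'C(n, h)))%N.
  under eq_bigr => U _ do rewrite cutE.
  rewrite -big_distrl exchange_big /= big_distrl /= -[RHS]sum_nat_const.
  apply: eq_bigr => -[x y]; rewrite inE /= => exy.
  have nxy : x != y by apply: contraTneq exy => ->; rewrite adj_irrefl.
  rewrite -(card_splitting h nxy) -sum1_card; congr muln.
  rewrite [RHS]big_mkcond [LHS]big_mkcond /=; apply: eq_bigr => U _.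
  by rewrite [U \in [set _ in _ | _]]inE; case: (U \in draws _ _); case: (x \in U); case: (y \in U).
have nn0R : 0 < (n * n.-1)%N%:R :> R by rewrite ltr0n.
have pE : p * (n * n.-1)%N%:R = 2 * #|edges G|%:R.
  have binE : (2 * 'C(n, 2) = n * n.-1)%N.
    by rewrite bin2 mul2n; have := odd_double_half (n * n.-1); rewrite oddM; case: (n) => //= m; rewrite andNb.
  have C0 : 'C(n, 2)%:R != 0 :> R by rewrite pnatr_eq0 -lt0n bin_gt0.
  by rewrite -binE natrM /p /edge_density -/n; field.
(* The cut is negated because the averaging lemma produces small values. *)
have [||U] := @exists_le_average R _ (draws [set: G] h) (fun U => - (cut U)%:R) (- (p * (h * (n - h))%N%:R)).
- by rewrite card_draws_in cardsT bin_gt0.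
- rewrite sumrN mulrN lerN2 -natr_sum card_draws_in cardsT -/n.
  rewrite -(ler_pM2r nn0R) -[X in _ <= X]natrM big_distrl /= sum_cut [X in _ <= X]natrM.
  rewrite (_ : _ * _ * _ = 2 * #|edges G|%:R * (h * (n - h) * 'C(n, h))%N%:R); last first.
    by rewrite -pE !natrM; ring.
  by rewrite ler_wpM2r ?ler0n // -natrM ler_nat edges_le_adj_pairs.
case/drawsP=> _ cU; rewrite lerN2; by exists U.
Qed.

(* One of the two sides of the cut keeps many vertices of degree at least
   [p n / 5] to the other side; if the first one is too small, the edges at
   its rich vertices are spread over many vertices of the other side. *)
Lemma exists_rich_pair (n : nat) (p : R) :
  #|G| = n -> (9 <= n)%N -> p = edge_density R G ->
  exists A B : {set G}, exists d : nat, [/\ [disjoint A & B],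
    #|A|%:R <= 5 / 9 * n%:R :> R, Num.sqrt p * n%:R / 5 <= #|B|%:R,
    p * n%:R / 5 <= d%:R & forall v, v \in B -> (d <= #|nbrs (@adj G) A v|)%N].
Proof.
move=> cG n9 pE; have p0 : 0 <= p by rewrite pE edge_density_ge0.
have p1 : p <= 1 by rewrite pE edge_density_le1.
have n0 : (0 : R) <= n%:R by rewrite ler0n.
have [d [dge dlt dmin]] : exists d : nat, [/\ p * n%:R / 5 <= d%:R,
    d%:R < p * n%:R / 5 + 1 & forall m : nat, p * n%:R / 5 <= m%:R -> (d <= m)%N].
  by apply: nat_ceil; rewrite divr_ge0 ?ler0n // mulr_ge0.
have poor (m : nat) : (m < d)%N -> m%:R <= p * n%:R / 5.
  by move=> ltm; rewrite leNgt; apply/negP => /ltW/dmin; rewrite leqNgt ltm.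
have [|U cU] := exists_bisection; first by rewrite cG; apply: leq_trans n9.
rewrite cG -pE => cut.
pose g : R := Num.sqrt p; rewrite -/g; have g0 : 0 <= g by rewrite sqrtr_ge0.
have gg : g ^+ 2 = p by rewrite sqr_sqrtr.
(* Vertices with [f v >= d] contribute at most [b] each, the others at most [p n / 5] by minimality
   of [d]. *)
have split_sum (X : {set G}) (f : G -> nat) (b : nat) :
    (forall v, v \in X -> f v <= b)%N ->
    (\sum_(v in X) f v)%N%:R <= #|[set v in X | (d <= f v)%N]|%:R * b%:R + #|X|%:R * (p * n%:R / 5).
  move=> fb; rewrite natr_sum (bigID (fun v => d <= f v)%N) /= lerD //.
    rewrite -natr_sum -natrM ler_nat -sum_nat_const big_mkcond [X in (_ <= X)%N]big_mkcond /=.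
    apply: leq_sum => v _; rewrite inE; case: ifP => // /andP[vX _]; exact: fb.
  rewrite -big_filter_cond /= mulr_natl -sumr_const.
  rewrite big_filter_cond /= big_mkcond [X in _ <= X]big_mkcond /=; apply: ler_sum => v _.
  case: (v \in X) => //=; case: ifP => [|_]; first by rewrite -ltnNge => /poor.
  by rewrite divr_ge0 ?ler0n // mulr_ge0.
have cW : #|~: U| = (n - n./2)%N by rewrite cardsCs setCK cU cG.
pose B0 := [set v in ~: U | d <= #|nbrs (@adj G) U v|]%N.
have sB0 : B0 \subset ~: U by apply/subsetP => v; rewrite inE => /andP[].
have dUB0 : [disjoint U & B0] by rewrite disjoint_sym disjoints_subset.
have half : (2 * n./2 <= n)%N by lia.
have halfR : 2 * (n./2)%:R <= n%:R :> R by rewrite -natrM ler_nat.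
have [bigB|smallB] := leP (g * n%:R / 5) #|B0|%:R.
  exists U, B0, d; split=> //; last by move=> v; rewrite inE => /andP[].
  by rewrite cU cG; move: halfR n0; lra.
pose A0 := [set u in U | d <= #|fnbrs (@adj G) B0 u|]%N.
have sA0 : A0 \subset U by apply/subsetP => v; rewrite inE => /andP[].
exists B0, A0, d; split=> //.
- rewrite disjoint_sym; exact: disjointWl dUB0.
- apply: le_trans (ltW smallB) _.
  have g1 : g <= 1 by rewrite -sqrtr1 ler_sqrt.
  have := ler_wpM2r n0 g1; move: n0; lra.
- have e1 : (\sum_(v in ~: U) #|nbrs (@adj G) U v|)%N%:R <=
      (\sum_(v in B0) #|nbrs (@adj G) U v|)%N%:R + #|~: U|%:R * (p * n%:R / 5).
    rewrite (big_setID B0) /= (setIidPr sB0) natrD lerD2l.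
    have := split_sum (~: U :\: B0) (fun v => #|nbrs (@adj G) U v|) #|G|.
    rewrite (_ : [set v in _ | _] = set0); last first.
      apply/setP => v; rewrite in_set0 !inE; case: (v \in U) => //=.
      by case: (d <= _)%N.
    rewrite cards0 mul0r add0r => /(_ _)/le_trans; apply.
      by move=> v _; apply: max_card.
    rewrite ler_wpM2r ?divr_ge0 ?ler0n ?mulr_ge0 // ler_nat subset_leq_card //.
    exact: subsetDl.
  have e2 : (\sum_(v in B0) #|nbrs (@adj G) U v|)%N%:R <=
      #|A0|%:R * #|B0|%:R + #|U|%:R * (p * n%:R / 5).
    rewrite -sum_fnbrs; apply: split_sum => u _; apply: subset_leq_card.
    by apply/subsetP => z; rewrite inE => /andP[].
  have UW : #|U|%:R + #|~: U|%:R = n%:R :> R by rewrite -natrD cardsC cG.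
  have hh : n%:R ^+ 2 - 1 <= 4 * (n./2 * (n - n./2))%N%:R :> R.
    rewrite lerBlDr -natrX -natrM natr1 ler_nat.
    exact: sqr_le_halves.
  have n9R : 9 <= n%:R :> R by rewrite ler_nat.
  rewrite leNgt; apply/negP => smallA.
  have gn : 0 <= g * n%:R / 5 by rewrite divr_ge0 ?ler0n // mulr_ge0.
  (* If both rich sets were small, the cut would be at most [(1/25 + 1/5) p n^2], but it is at least
     [p (n^2 - 1) / 4]; this is impossible for [n >= 9]. *)
  have prod : #|A0|%:R * #|B0|%:R <= p * n%:R ^+ 2 / 25.
    apply: (@le_trans _ _ (g * n%:R / 5 * (g * n%:R / 5))).
      by apply: ler_pM; rewrite ?ler0n // ltW.
    by rewrite -gg le_eqVlt; apply/orP; left; apply/eqP; field.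
  have g_gt0 : 0 < g.
    rewrite lt_neqAle g0 andbT eq_sym; apply: contraTneq smallA => ->.
    by rewrite !mul0r -leNgt ler0n.
  have p_gt0 : 0 < p by rewrite -gg exprn_gt0.
  have := ler_wpM2l p0 hh.
  have : #|U|%:R * (p * n%:R / 5) + #|~: U|%:R * (p * n%:R / 5) = p * n%:R ^+ 2 / 5.
    by rewrite -mulrDl UW; field.
  have : p * 81 <= p * n%:R ^+ 2.
    by rewrite ler_pM2l //; move: n9R; clear; nra.
  move: cut e1 e2 prod p_gt0; clear; lra.
- move=> u; rewrite inE => /andP[_]; congr (_ <= _)%N; apply: eq_card => v.
  by rewrite !inE adj_sym.
Qed.

End Bisection.

(** * Exponential estimates and case (3) *)

Section LongCase.

Variable R : realType.
Implicit Types (p x y u : R).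

Lemma expR_le_inv u : u < 1 -> expR u <= (1 - u)^-1.
Proof.
move=> u1; have u0 : 0 < 1 - u by rewrite subr_gt0.
rewrite -[u in expR u]opprK expRN lef_pV2 ?posrE ?expR_gt0 //.
exact: expR_ge1Dx.
Qed.

Lemma onem_le_expRN u : 1 - u <= expR (- u).
Proof. exact: expR_ge1Dx. Qed.

Lemma expRN_double_le_onem u : 0 <= u <= 2^-1 -> expR (- (2 * u)) <= 1 - u.
Proof.
move=> /andP[u0 u1]; apply: (@le_trans _ _ ((1 + 2 * u)^-1)).
  by rewrite expRN lef_pV2 ?posrE ?expR_gt0 ?expR_ge1Dx //; lra.
rewrite invf_ple ?posrE; [|lra|lra].
by rewrite -[X in X <= _]div1r ler_pdivrMr; [nra|lra].
Qed.

Lemma ln2_ge_half : 2^-1 <= ln 2 :> R.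
Proof.
have : expR 2^-1 <= 2 :> R.
  apply: le_trans (expR_le_inv _) _; first lra.
  by rewrite (_ : 1 - 2^-1 = 2^-1) ?invrK //; lra.
by move=> le2; rewrite -[2^-1]expRK ler_ln ?posrE ?expR_gt0 ?ltr0n.
Qed.

Lemma ln2_le_34 : ln 2 <= 3 / 4 :> R.
Proof.
(* The eighth power of this linear bound already exceeds 2. *)
have e8 : 1 + 3 / 32 <= expR (3 / 32) :> R by apply: expR_ge1Dx.
have : 2 <= expR (3 / 4) :> R.
  have -> : 3 / 4 = 8%:R * (3 / 32) :> R by lra.
  rewrite expRM_natl; apply: (@le_trans _ _ ((1 + 3 / 32) ^+ 8)); first lra.
  by rewrite lerXn2r // ?nnegrE ?expR_ge0 //; lra.
by move=> le2; rewrite -[X in _ <= X]expRK ler_ln ?posrE ?expR_gt0 ?ltr0n.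
Qed.

Lemma mul_le_expR (x : R) : 1000 <= x -> 1000 * x <= expR (x / 12).
Proof.
move=> x0; set y := x / 12; have -> : x = 12 * y by rewrite /y; lra.
have y80 : 80 <= y by rewrite /y; lra.
have y0 : 0 <= y by move: y80; lra.
have := expR_ge1Dxn 3 y0; rewrite (_ : 4`!%:R = 24 :> R) // => /(le_trans _); apply.
have h1 : 80 * y <= y ^+ 2 by rewrite expr2 ler_wpM2r.
have h2 : 80 * y ^+ 2 <= y ^+ 3 by rewrite [y ^+ 3]exprS ler_wpM2r ?sqr_ge0.
have h3 : 80 * y ^+ 3 <= y ^+ 4 by rewrite [y ^+ 4]exprS ler_wpM2r ?exprn_ge0.
by move: h1 h2 h3 y0; clear; lra.
Qed.

(** The Taylor term of degree five suffices. The factor 50 is what [N * r <= p * n / 100] asks for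
    in case (2). *)
Lemma sqr_le_expR (x : R) : 1000 <= x -> 50 * x ^+ 2 <= expR (x / 10).
Proof.
move=> x0; set y := x / 10; have -> : x = 10 * y by rewrite /y; lra.
have y100 : 100 <= y by rewrite /y; lra.
have y0 : 0 <= y by move: y100; lra.
have := expR_ge1Dxn 4 y0; rewrite (_ : 5`!%:R = 120 :> R) // => /(le_trans _); apply.
have h1 : 100 * y ^+ 2 <= y ^+ 3 by rewrite [y ^+ 3]exprS ler_wpM2r ?sqr_ge0.
have h2 : 100 * y ^+ 3 <= y ^+ 4 by rewrite [y ^+ 4]exprS ler_wpM2r ?exprn_ge0.
have h3 : 100 * y ^+ 4 <= y ^+ 5 by rewrite [y ^+ 5]exprS ler_wpM2r ?exprn_ge0.
have h4 : 0 <= y ^+ 2 by apply: sqr_ge0.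
by move: h1 h2 h3 h4; clear; lra.
Qed.

Lemma bicomplete_of_long (G : sgraph) (p : R) (n r t : nat) :
  #|G| = n -> (9 <= n)%N -> p = edge_density R G -> 0 < p -> (0 < t)%N ->
  1 <= log2 (n%:R : R) ->
  4 * Num.sqrt (p^-1 * log2 n%:R) <= r%:R ->
  t%:R <= p * n%:R / (64 * Num.sqrt (log2 n%:R)) ->
  t%:R <= n%:R / (2 * r%:R) :> R ->
  has_weakly_bicomplete G r t.
Proof.
move=> cG n9 pE p0 t0 L1 le_r le_t1 le_t2.
have p1 : p <= 1 by rewrite pE edge_density_le1.
have nR0 : 0 < n%:R :> R by rewrite ltr0n (leq_trans _ n9).
have tR1 : 1 <= t%:R :> R by rewrite ler1n.
set L := log2 (n%:R : R) in L1 le_r le_t1.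
have nE : n%:R = expR (L * ln 2).
  by rewrite /L /log2 divfK ?lnK ?posrE // gt_eqF // (lt_le_trans _ ln2_ge_half) // invr_gt0 ltr0n.
set z := Num.sqrt (p^-1 * L) in le_r; set l := Num.sqrt L in le_t1.
pose g : R := Num.sqrt p.
have L0 : 0 <= L by lra.
have pV0 : 0 < p^-1 by rewrite invr_gt0.
have g0 : 0 < g by rewrite sqrtr_gt0.
have gg : g * g = p by rewrite -expr2 sqr_sqrtr // ltW.
have ll : l * l = L by rewrite -expr2 sqr_sqrtr.
have l1 : 1 <= l by rewrite -sqrtr1 ler_sqrt //; lra.
have zg : z * g = l.
  have pL0 : 0 <= p^-1 * L by rewrite mulr_ge0 // ltW.
  by rewrite /z /g -(sqrtrM _ pL0) mulrAC mulVf ?mul1r // gt_eqF.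
have g1 : g <= 1 by rewrite -sqrtr1 ler_sqrt.
have z0 : 0 <= z by rewrite sqrtr_ge0.
have lz : l <= z by rewrite -zg ler_piMr.
have z1 : 1 <= z by apply: le_trans lz.
have [r0 [r0ge r0lt r0min]] : exists r0 : nat, [/\ 4 * z <= r0%:R, r0%:R < 4 * z + 1
    & forall m : nat, 4 * z <= m%:R -> (r0 <= m)%N].
  by apply: nat_ceil; rewrite mulr_ge0.
have le_r0 : (r0 <= r)%N by apply: r0min.
have r0pos : 0 < r0%:R :> R by move: r0ge z1; lra.
have le_n : (2 * r * t <= n)%N.
  rewrite -(ler_nat R) natrM mulrC natrM; move: le_t2; rewrite ler_pdivlMr //.
  by rewrite mulr_gt0 ?ltr0n // -(ltr0n R) (lt_le_trans r0pos) // ler_nat.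
have tl : 64 * l * t%:R <= p * n%:R.
  by move: le_t1; rewrite ler_pdivlMr ?[t%:R * _]mulrC // mulr_gt0 ?ltr0n // (lt_le_trans _ l1).
have tz : 64 * (t%:R * z) <= g * n%:R.
  have l0 : 0 < l by move: l1; lra.
  rewrite -(ler_pM2r l0); have := ler_wpM2r z0 tl; rewrite -gg -zg.
  by move: (t%:R : R) (n%:R : R) => T M; lra.
have [A [B [d [dAB leA leB led deg]]]] := exists_rich_pair cG n9 pE.
have trB : (2 * t * r0 <= #|B|)%N.
  rewrite -(ler_nat R) (le_trans _ leB) // !natrM -/g.
  have : t%:R * r0%:R <= t%:R * (5 * z) by rewrite ler_wpM2l ?ler0n //; move: r0lt z1; lra.
  have gn0 : 0 <= g * n%:R by rewrite mulr_ge0 // ltW.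
  by move: tz gn0; clear; lra.
have pr0 : 16 * L <= p * r0%:R ^+ 2.
  have -> : 16 * L = p * (4 * z) ^+ 2 by rewrite -ll -zg -gg; ring.
  by rewrite ler_pM2l // lerXn2r // ?nnegrE ?mulr_ge0 // ltW.
have d0 : 0 < d%:R :> R by rewrite (lt_le_trans _ led) // divr_gt0 ?mulr_gt0.
have tn : t%:R <= n%:R / 64 :> R.
  have : t%:R <= l * t%:R by rewrite ler_peMl ?ler0n.
  have : p * n%:R <= n%:R by rewrite ler_piMl // ltW.
  by move: tl; clear; lra.
have B0 : (0 < #|B|)%N.
  apply: leq_trans trB; rewrite !muln_gt0 t0 /= -(ltr0n R); exact: r0pos.
suff [rho [lS [sS dS okS unhS small]]] : exists (rho : R) lS, [/\ size lS = t,
    pairwise (@disj G) lS, forall S, S \in lS -> S \subset A /\ (#|S| <= r0)%N,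
    forall S, S \in lS -> #|unhit (@adj G) B S|%:R <= rho * #|B|%:R
    & t%:R * rho ^+ r0 < 2^-1].
  have [lT [sT dT okT hit]] := hitting_family sS trB unhS small.
  apply: (@bicomplete_of_families G A B r t lS lT) => //; first by rewrite cG.
    by move=> S /okS[? cS]; split=> //; apply: leq_trans cS le_r0.
  by move=> T /okT/drawsP[? ->].
(* Since [L * ln 2 = ln n], the hypotheses give [rho ^+ r0 <= 1 / n], and [t <= n / 64]. *)
have tail (rho v : R) : 0 <= rho -> rho <= expR (- v) -> L * ln 2 <= v * r0%:R ->
    t%:R * rho ^+ r0 < 2^-1.
  move=> rho0 le_rho le_v; apply: (@le_lt_trans _ _ (64^-1)); last lra.
  apply: (@le_trans _ _ (n%:R / 64 * expR (- v) ^+ r0)).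
    by apply: ler_pM; rewrite ?ler0n ?exprn_ge0 // lerXn2r // nnegrE ?expR_ge0.
  rewrite -expRM_natr mulrAC ler_piMl ?invr_ge0 ?ler0n // {1}nE -expRD -[X in _ <= X]expR0 ler_expR.
  by move: le_v; rewrite mulNr; lra.
have ln2 := ln2_le_34; have ln2' := ln2_ge_half.
have [dense|sparse] := leP (r0%:R) (6 * L).
(* The largest size up to [r0] for which [2 * t] disjoint sets fit into [A]. *)
- pose s := minn r0 (#|A| %/ (2 * t)).
  have [|lS [sS dS okS unhS]] := covering_draws R (t := t) (s := s) deg.
    rewrite /s; apply: (@leq_trans (2 * t * (#|A| %/ (2 * t)))).
      by rewrite leq_mul2l geq_minr orbT.
    by rewrite mulnC leq_divM.
  exists (2 * (1 - d%:R / #|A|%:R) ^+ s), lS; split=> //.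
    by move=> S /okS/drawsP[? ->]; rewrite geq_minl.
  set q := d%:R / #|A|%:R.
  have dA : (d <= #|A|)%N.
    case/card_gt0P: B0 => v /deg/leq_trans; apply; apply: subset_leq_card.
    by apply/subsetP => u; rewrite inE => /andP[].
  have A0 : 0 < #|A|%:R :> R by rewrite (lt_le_trans d0) // ler_nat.
  have q1 : q <= 1 by rewrite ler_pdivrMr // mul1r ler_nat.
  have q0 : 0 < q by rewrite divr_gt0.
  have qA : q * #|A|%:R = d%:R by rewrite divfK // gt_eqF.
  have qp : 9 / 25 * p <= q.
    rewrite ler_pdivlMr //; apply: le_trans led.
    have := ler_wpM2l (ltW p0) leA; lra.
  have onem : 0 <= 1 - q by rewrite subr_ge0.
  apply: (@tail _ (q * s%:R - ln 2)).
  + by rewrite mulr_ge0 ?ler0n ?exprn_ge0.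
  + rewrite opprB expRD lnK ?posrE ?ltr0n // ler_wpM2l ?ler0n //.
    by rewrite -[- (q * _)]mulNr expRM_natr lerXn2r ?nnegrE ?expR_ge0 // onem_le_expRN.
  (* Markov's factor 2 costs [ln 2 * r0 <= 9/2 * L], by [r0 <= 6 * L]; what remains of [28/5 * L]
     exceeds [L * ln 2]. *)
  have qsr : 28 / 5 * L <= q * s%:R * r0%:R.
    have [le_s|lt_s] := leqP r0 (#|A| %/ (2 * t)).
      rewrite /s (minn_idPl le_s).
      have r2 : 0 <= r0%:R ^+ 2 :> R by apply: sqr_ge0.
      by have := ler_wpM2r r2 qp; move: pr0 L0; lra.
    rewrite /s (minn_idPr (ltnW lt_s)); set k := (#|A| %/ (2 * t))%N.
    have lt_k : #|A|%:R <= (k%:R + 1) * (2 * t%:R) :> R.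
      by rewrite natr1 -!natrM ler_nat ltnW // ltn_ceil // muln_gt0.
    have qk : 27 / 5 * l <= q * k%:R.
      have tpos : 0 < 2 * t%:R :> R by rewrite mulr_gt0 ?ltr0n.
      rewrite -(ler_pM2r tpos).
      have h1 := ler_wpM2l (ltW q0) lt_k; rewrite qA in h1.
      have h2 : q * (2 * t%:R) <= l * (2 * t%:R).
        by rewrite ler_pM2r // (le_trans q1).
      by move: h1 h2 led tl; clear; lra.
    have h : 27 / 5 * l * (4 * l) <= q * k%:R * r0%:R.
      apply: ler_pM => //; [by move: l1; lra|by move: l1; lra|].
      by move: lz r0ge; lra.
    by move: h; rewrite -ll; have : 0 <= l * l by [rewrite ll]; lra.
  have := ler_wpM2r L0 ln2; have := ler_wpM2r (ltW r0pos) ln2.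
  by move: qsr dense L0; clear; lra.
(* Chosen so that [eps * r0 = 3/4 * L >= L * ln 2], as [tail] asks; [r0 > 6 * L] gives
   [eps <= 1/8]. *)
pose eps := 3 / 4 * L / r0%:R.
have epsr : eps * r0%:R = 3 / 4 * L by rewrite divfK // gt_eqF.
have eps0 : 0 < eps by rewrite divr_gt0 // mulr_gt0 //; [lra|move: L1; lra].
have eps8 : eps <= 8^-1 by rewrite ler_pdivrMr //; move: sparse; lra.
have [|||||lS [sS dS okS unhS]] := @sparse_cover R _ (@adj G) A B d r0 t eps.
- by rewrite eps0 /=; move: eps8; lra.
- by rewrite -(ltr0n R).
- exact: B0.
- exact: deg.
- have h1 : 2 * #|A|%:R * eps / r0%:R <= p * n%:R * (5 / 96).
    rewrite ler_pdivrMr // -(ler_pM2r r0pos).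
    have -> : 2 * #|A|%:R * eps * r0%:R = 2 * #|A|%:R * (eps * r0%:R) by ring.
    rewrite epsr.
    have h1 := ler_wpM2r L0 leA; have h2 := ler_wpM2l (ltW nR0) pr0.
    by move: h1 h2; clear; lra.
  have h2 : d%:R * eps <= d%:R / 8 by rewrite ler_pM2l.
  have h3 : t%:R <= l * t%:R by rewrite ler_peMl ?ler0n.
  by move: h1 h2 h3 tl led d0; clear; lra.
exists (1 - eps), lS; split=> //.
apply: (tail _ eps); first by move: eps8; lra.
  exact: onem_le_expRN.
by rewrite epsr; have := ler_wpM2r L0 ln2; lra.
Qed.

End LongCase.

(** * Cases (1) and (2) *)

Section ShortMedium.

Variable R : realType.
Implicit Types (p : R).

(** The rich pair enters the dense scheme with [q = p / 3]: as [|A| <= 5 n / 9], the sum of [q |A|]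
    and [p n / 100] stays below the degree bound [p n / 5]. *)
Lemma bicomplete_of_room (G : sgraph) (p rho kap th : R) (n N r t : nat) :
  #|G| = n -> (9 <= n)%N -> p = edge_density R G -> 0 < p ->
  (N * r)%:R <= p * n%:R / 100 -> expR (- (p * r%:R ^+ 2 / 3)) <= rho ->
  0 < kap -> 0 <= th <= 1 -> (2 * t <= N)%N ->
  kap * N%:R <= (N - t)%:R * (1 - th) ->
  0 <= (1 - rho / kap) * th ^+ t ->
  t%:R * r%:R ^+ 2 < (1 - rho / kap) * th ^+ t * (p * n%:R / 5) ->
  has_weakly_bicomplete G r t.
Proof.
move=> cG n9 pE p0 le_Nr le_rho kap0 th01 le_tN le_kap c0 room.
have p1 : p <= 1 by rewrite pE edge_density_le1.
have n0 : 0 <= n%:R :> R by rewrite ler0n.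
have [A [B [d [dAB leA leB led deg]]]] := exists_rich_pair cG n9 pE.
have pn0 : 0 <= p * n%:R by rewrite mulr_ge0 // ltW.
have q01 : 0 <= p / 3 <= 1 by move: p0 p1; clear; lra.
have [|||||lS [lT [[sS sT] [dS dT] okS okT hit]]] :=
    @bicomplete_pairs_of_dense R _ (@adj G) (p / 3) d%:R rho kap th N t r A B q01
      _ _ _ kap0 th01 _ le_kap _.
- apply: le_trans led; have := ler_wpM2l (ltW p0) leA.
  by move: le_Nr pn0; clear; lra.
- by move=> v vB; rewrite ler_nat deg.
- apply: le_trans le_rho.
  apply: (@le_trans _ _ (expR (- (p / 3)) ^+ (r * r))).
    by rewrite lerXn2r ?nnegrE ?expR_ge0 ?onem_le_expRN //; move: p1; lra.
  rewrite -expRM_natr ler_expR natrM -expr2 le_eqVlt; apply/orP; left; apply/eqP.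
  by field.
- by apply: leq_trans le_tN; rewrite mul2n -addnn leq_addl.
- rewrite -mulnA natrM natrM -expr2; apply: lt_le_trans room _.
  rewrite ler_wpM2l //; apply: le_trans leB.
  rewrite ler_pM2r ?invr_gt0 ?ltr0n // ler_wpM2r //.
  have gg : Num.sqrt p * Num.sqrt p = p by rewrite -expr2 sqr_sqrtr // ltW.
  by rewrite -{1}gg ler_piMr ?sqrtr_ge0 // -sqrtr1 ler_sqrt.
apply: (@bicomplete_of_families G A B r t lS lT) => //.
rewrite cG -(ler_nat R); apply: (@le_trans _ _ (N * r)%:R).
  by rewrite ler_nat mulnAC leq_mul2r le_tN orbT.
apply: le_trans le_Nr _; have : p * n%:R <= n%:R by rewrite ler_piMl.
by move: n0; clear; lra.
Qed.

(** With [y = p r^2 <= 4] the scheme runs with [rho = 1 - y/7], [kap = 1 - y/14], [th = y/32] and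
    [N] the ceiling of [32 t / y]. Then [1 - rho / kap >= y/14], and the bound on [t] gives
    [th ^+ t >= n^(-1/4)]. *)
Lemma bicomplete_of_short (G : sgraph) (p : R) (n r t : nat) :
  #|G| = n -> (9 <= n)%N -> p = edge_density R G -> (0 < t)%N -> (0 < r)%N ->
  1000 <= ln (n%:R : R) ->
  n%:R `^ (- 3^-1) <= p -> r%:R <= 2 * p `^ (- 2^-1) ->
  t%:R <= log2 n%:R / (4 * log2 (32 / (p * r%:R ^+ 2))) ->
  has_weakly_bicomplete G r t.
Proof.
move=> cG n9 pE t0 r0 x1000 le_p le_r le_t.
have nR0 : 0 < n%:R :> R by rewrite ltr0n (leq_trans _ n9).
have p1 : p <= 1 by rewrite pE edge_density_le1.
set x := ln (n%:R : R) in x1000.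
have nE : n%:R = expR x by rewrite lnK.
have le_p' : expR (- (x / 3)) <= p.
  by move: le_p; rewrite /powR gt_eqF // mulNr mulrC.
have p0 : 0 < p by apply: lt_le_trans le_p'; apply: expR_gt0.
have rR1 : 1 <= r%:R :> R by rewrite ler1n.
have tR1 : 1 <= t%:R :> R by rewrite ler1n.
set y := p * r%:R ^+ 2 in le_t.
have y0 : 0 < y by rewrite mulr_gt0 // exprn_gt0 // ltr0n.
have g0 : 0 < Num.sqrt p by rewrite sqrtr_gt0.
have gg : Num.sqrt p * Num.sqrt p = p by rewrite -expr2 sqr_sqrtr // ltW.
have rg : r%:R * Num.sqrt p <= 2.
  by move: le_r; rewrite powRN (powR12_sqrt (ltW p0)) ler_pdivlMr.
have y4 : y <= 4.
  have -> : y = (r%:R * Num.sqrt p) ^+ 2 by rewrite exprMn [Num.sqrt p ^+ 2]expr2 gg mulrC.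
  have -> : 4 = 2 ^+ 2 :> R by rewrite -natrX.
  by rewrite lerXn2r // nnegrE ?ler0n // mulr_ge0 ?ler0n // ltW.
have ry : r%:R <= 2 / p.
  rewrite ler_pdivlMr // -gg mulrA (le_trans (ler_wpM2r (ltW g0) rg)) //.
  by rewrite ler_piMr // -sqrtr1 ler_sqrt.
pose w := ln (32 / y).
have w1 : 1 <= w.
  have h8 : 8 <= 32 / y by rewrite ler_pdivlMr //; move: (y) y4 => v; clear; lra.
  apply: (@le_trans _ _ (ln 8)); last by rewrite ler_ln ?posrE ?divr_gt0 ?ltr0n.
  have -> : 8 = 2 ^+ 3 :> R by rewrite -natrX.
  by rewrite lnXn // mulrS mulrS mulr1n; have := ln2_ge_half R; lra.
have tw : 4 * t%:R * w <= x.
  have ln20 : 0 < ln 2 :> R by have := ln2_ge_half R; lra.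
  move: le_t; rewrite /log2 -/w -/x.
  have -> : x / ln 2 / (4 * (w / ln 2)) = x / (4 * w).
    by field; rewrite !gt_eqF //; move: w1; lra.
  by rewrite ler_pdivlMr; [move: w1; lra | move: w1; lra].
have tx : 4 * t%:R <= x by have := ler_wpM2l (ltW (lt_le_trans ltr01 tR1)) w1; move: tw; clear; lra.
(* That is, [p^2 n >= n^(1/3)]; the surplus over the [n^(1/4)] lost to [th ^+ t] absorbs factors
   linear in [ln n]. *)
have p2n : expR (x / 3) <= p * (p * n%:R).
  have -> : expR (x / 3) = expR (- (x / 3)) * (expR (- (x / 3)) * n%:R).
    by rewrite nE -!expRD; congr expR; field.
  by apply: ler_pM; rewrite ?mulr_ge0 ?expR_ge0 ?ler0n // ler_pM2r.
have xe := mul_le_expR x1000.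
have e12 : expR (x / 12) <= expR (x / 3) by rewrite ler_expR; move: x1000; lra.
have [N [Nge Nlt _]] : exists N : nat, [/\ 32 * t%:R / y <= N%:R,
    N%:R < 32 * t%:R / y + 1 & forall m : nat, 32 * t%:R / y <= m%:R -> (N <= m)%N].
  by apply: nat_ceil; rewrite divr_ge0 ?mulr_ge0 ?ler0n // ltW.
have Ny : 32 * t%:R <= N%:R * y by rewrite -ler_pdivrMr.
have le_tN : (2 * t <= N)%N.
  rewrite -(ler_nat R) natrM.
  by have := ler_wpM2l (ler0n R N) y4; move: Ny tR1; clear; lra.
have k0 : 0 < 1 - y / 14 by move: y4; lra.
have kapE : y / 14 <= 1 - (1 - y / 7) / (1 - y / 14).
  rewrite lerBrDr -lerBrDl ler_pdivrMr //; have := sqr_ge0 (y / 14).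
  by clear; lra.
have thE : expR (- (x / 4)) <= (y / 32) ^+ t.
  have -> : y / 32 = expR (- w).
    by rewrite expRN lnK ?posrE ?divr_gt0 ?ltr0n // invf_div.
  by rewrite -expRM_natr ler_expR; move: tw; clear; lra.
have prodE : y / 14 * expR (- (x / 4)) <=
    (1 - (1 - y / 7) / (1 - y / 14)) * (y / 32) ^+ t.
  by apply: ler_pM; rewrite ?expR_ge0 // divr_ge0 ?ler0n // ltW.
apply: (@bicomplete_of_room G p (1 - y / 7) (1 - y / 14) (y / 32) n N r t) => //.
- have pV : p * p^-1 = 1 by rewrite divff // gt_eqF.
  have h : N%:R * r%:R <= (32 * t%:R + 2) / p.
    apply: (@le_trans _ _ ((32 * t%:R / y + 1) * r%:R)).
      by rewrite ler_wpM2r ?ler0n // ltW.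
    have -> : (32 * t%:R / y + 1) * r%:R = 32 * t%:R / (p * r%:R) + r%:R.
      by rewrite /y; field; rewrite !gt_eqF // ltr0n.
    rewrite [X in _ <= X]mulrDl lerD //.
    rewrite ler_pM2l ?mulr_gt0 ?ltr0n // lef_pV2 ?posrE ?mulr_gt0 ?ltr0n //.
    by rewrite ler_pMr.
  rewrite natrM; apply: le_trans h _.
  rewrite ler_pdivrMr //.
  by move: tx x1000 xe e12 p2n; clear; lra.
(* For positive [y], the bound [1 / (1 + y/3) <= 1 - y/7] holds exactly up to [y = 4]. *)
- have h : expR (- (y / 3)) <= (1 + y / 3)^-1.
    by rewrite expRN lef_pV2 ?posrE ?expR_gt0 ?expR_ge1Dx //; move: y0; lra.
  apply: le_trans h _; rewrite -[X in X <= _]div1r ler_pdivrMr; last by move: y0; lra.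
  by move: y0 y4; clear; nra.
- by move: y0 y4; clear; lra.
- rewrite natrB; last by apply: leq_trans le_tN; rewrite mul2n -addnn leq_addl.
  by have := ler_wpM2r (ltW y0) tR1; move: Ny tR1 y4 y0; clear; lra.
- by apply: le_trans prodE; rewrite mulr_ge0 ?expR_ge0 // divr_ge0 ?ler0n // ltW.
apply: lt_le_trans (ler_wpM2r _ prodE); last by rewrite divr_ge0 // mulr_ge0 // ltW.
have e0 : 0 < expR (x / 4) by apply: expR_gt0.
have c0 : 0 < y / (70 * p * expR (x / 4)) by rewrite divr_gt0 // !mulr_gt0 // ltr0n.
have -> : t%:R * r%:R ^+ 2 = y / (70 * p * expR (x / 4)) * (70 * t%:R * expR (x / 4)).
  by rewrite /y; field; rewrite !gt_eqF.
have -> : y / 14 * expR (- (x / 4)) * (p * n%:R / 5) =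
    y / (70 * p * expR (x / 4)) * (p * (p * n%:R)).
  by rewrite expRN; field; rewrite !gt_eqF.
rewrite ltr_pM2l //; apply: lt_le_trans p2n.
have -> : expR (x / 3) = expR (x / 12) * expR (x / 4) by rewrite -expRD; congr expR; field.
by rewrite ltr_pM2r //; move: tx xe x1000; clear; lra.
Qed.

(** Now [y = p r^2 >= 16] makes [rho = exp(-y/3)] small. The choices [kap = 2 rho],
    [th = 1 - 4 rho], [N = 2 t] turn the counting condition into an equality. *)
Lemma bicomplete_of_medium (G : sgraph) (p : R) (n r t : nat) :
  #|G| = n -> (9 <= n)%N -> p = edge_density R G -> (0 < t)%N ->
  1000 <= ln (n%:R : R) ->
  n%:R `^ (- 5^-1) <= p -> 4 * p `^ (- 2^-1) <= r%:R ->
  r%:R <= Num.sqrt (p^-1 * log2 n%:R) ->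
  t%:R <= 16^-1 * expR (p * r%:R ^+ 2 / 8) * log2 n%:R ->
  has_weakly_bicomplete G r t.
Proof.
move=> cG n9 pE t0 x1000 le_p ge_r le_r le_t.
have nR0 : 0 < n%:R :> R by rewrite ltr0n (leq_trans _ n9).
have p1 : p <= 1 by rewrite pE edge_density_le1.
set L := log2 (n%:R : R) in le_r le_t; set x := ln (n%:R : R) in x1000.
have nE : n%:R = expR x by rewrite lnK.
have ln2 := ln2_ge_half R.
have ln20 : 0 < ln 2 :> R by move: ln2; lra.
have L0 : 0 < L by rewrite divr_gt0 //; move: x1000; rewrite -/x; lra.
have Lx : L <= 2 * x.
  rewrite ler_pdivrMr // -/x; have x0 : 0 <= x by move: x1000; lra.
  by have := ler_wpM2l x0 ln2; lra.
have le_p' : expR (- (x / 5)) <= p.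
  by move: le_p; rewrite /powR gt_eqF // mulNr mulrC.
have p0 : 0 < p by apply: lt_le_trans le_p'; apply: expR_gt0.
have tR1 : 1 <= t%:R :> R by rewrite ler1n.
have g0 : 0 < Num.sqrt p by rewrite sqrtr_gt0.
have gg : Num.sqrt p * Num.sqrt p = p by rewrite -expr2 sqr_sqrtr // ltW.
have rg : 4 <= r%:R * Num.sqrt p.
  by move: ge_r; rewrite powRN (powR12_sqrt (ltW p0)) ler_pdivrMr.
set y := p * r%:R ^+ 2 in le_t.
have y16 : 16 <= y.
  have -> : y = (r%:R * Num.sqrt p) ^+ 2 by rewrite exprMn [Num.sqrt p ^+ 2]expr2 gg mulrC.
  have -> : 16 = 4 ^+ 2 :> R by rewrite -natrX.
  by rewrite lerXn2r // nnegrE ?ler0n // mulr_ge0 ?ler0n // ltW.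
have r2 : r%:R ^+ 2 <= L / p.
  rewrite mulrC -[X in _ <= X]sqr_sqrtr ?lerXn2r ?nnegrE ?ler0n ?sqrtr_ge0 //.
  by rewrite mulr_ge0 // ltW // invr_gt0.
have yL : y <= L by move: r2; rewrite ler_pdivlMr // mulrC.
have r1 : 1 <= r%:R :> R.
  rewrite ler1n lt0n; apply/negP => /eqP r0; move: rg; rewrite r0 mul0r; lra.
have rr2 : r%:R <= r%:R ^+ 2 :> R by rewrite expr2 ler_peMr ?ler0n.
have tx : t%:R <= x / 8 * expR (x / 4).
  apply: le_trans le_t _; rewrite mulrAC; apply: ler_pM; rewrite ?expR_ge0 //.
  - by move: L0; lra.
  - by move: Lx; lra.
  - by rewrite ler_expR; move: yL Lx; lra.
have tr2 : t%:R * r%:R ^+ 2 <= x ^+ 2 / 4 * expR (x / 4) / p.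
  have r2x : r%:R ^+ 2 <= 2 * x / p.
    by apply: le_trans r2 _; rewrite ler_pM2r ?invr_gt0.
  have := ler_pM (ler0n R t) (sqr_ge0 _) tx r2x; move/le_trans; apply.
  by rewrite le_eqVlt; apply/orP; left; apply/eqP; field; rewrite gt_eqF.
(* That is, [p^2 n >= n^(3/5)], against the [n^(1/2)] times a multiple of [(ln n)^2] required at the
   end. *)
have p2n : expR (x * (3 / 5)) <= p * (p * n%:R).
  have -> : expR (x * (3 / 5)) = expR (- (x / 5)) * (expR (- (x / 5)) * n%:R).
    by rewrite nE -!expRD; congr expR; field.
  by apply: ler_pM; rewrite ?mulr_ge0 ?expR_ge0 ?ler0n // ler_pM2r.
have xe := sqr_le_expR x1000.
have e4 : 0 < expR (x / 4) by apply: expR_gt0.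
have x2 : 0 <= x ^+ 2 by apply: sqr_ge0.
pose rho := expR (- (y / 3)).
have rho0 : 0 < rho by apply: expR_gt0.
have rho8 : rho <= 8^-1.
  have -> : rho = expR (- (y / 6)) ^+ 2.
    by rewrite -expRM_natr; congr expR; field.
  have h : expR (- (y / 6)) <= 3 / 11.
    apply: (@le_trans _ _ (expR (- (8 / 3)))); first by rewrite ler_expR; move: y16; lra.
    rewrite expRN -[3 / 11]invrK lef_pV2 ?posrE ?expR_gt0 //; last by rewrite invr_gt0; lra.
    by apply: le_trans (expR_ge1Dx _); rewrite invf_div; lra.
  apply: (@le_trans _ _ ((3 / 11) ^+ 2)); last lra.
  by rewrite lerXn2r ?nnegrE ?expR_ge0 //; lra.
(* As [rho * exp(y/8) <= exp(-3)], the bound on [t] limits [rho * t], which keeps [th ^+ t] above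
   [n^(-1/4)]. *)
have rhot : 8 * (rho * t%:R) <= x / 4.
  have h : rho * t%:R <= 16^-1 * L * (rho * expR (y / 8)).
    by have := ler_wpM2l (ltW rho0) le_t; move/le_trans; apply; lra.
  have h2 : rho * expR (y / 8) <= 4^-1.
    rewrite -expRD; apply: (@le_trans _ _ (expR (- 3))).
      by rewrite ler_expR; move: y16; lra.
    by rewrite expRN lef_pV2 ?posrE ?expR_gt0 ?ltr0n //; apply: le_trans (expR_ge1Dx _); lra.
  have h3 : 0 <= 16^-1 * L by move: L0; lra.
  by have := ler_wpM2l h3 h2; move: h Lx; clear; lra.
have thE : expR (- (x / 4)) <= (1 - 4 * rho) ^+ t.
  have h : expR (- (2 * (4 * rho))) <= 1 - 4 * rho.
    by apply: expRN_double_le_onem; move: rho0 rho8; clear; lra.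
  apply: (@le_trans _ _ (expR (- (2 * (4 * rho))) ^+ t)).
    by rewrite -expRM_natr ler_expR; move: rhot; clear; lra.
  by rewrite lerXn2r ?nnegrE ?expR_ge0 //; move: rho8; lra.
have kapE : 1 - rho / (2 * rho) = 2^-1 by field; rewrite gt_eqF.
apply: (@bicomplete_of_room G p rho (2 * rho) (1 - 4 * rho) n (2 * t) r t) => //.
- rewrite !natrM -mulrA.
  apply: (@le_trans _ _ (2 * (x ^+ 2 / 4 * expR (x / 4) / p))).
    rewrite ler_pM2l ?ltr0n //; apply: le_trans tr2.
    by rewrite ler_wpM2l ?ler0n.
  rewrite mulrA ler_pdivrMr //.
  have h : expR (x / 10) * expR (x / 4) <= p * (p * n%:R).
    by apply: le_trans p2n; rewrite -expRD ler_expR; move: x1000; lra.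
  by have := ler_wpM2r (ltW e4) xe; move: h; clear; lra.
- by rewrite mulr_gt0 ?ltr0n.
- by move: rho0 rho8; clear; lra.
- rewrite mul2n -addnn addnK natrD; lra.
- rewrite kapE mulr_ge0 ?invr_ge0 ?ler0n //; apply: le_trans thE; exact: expR_ge0.
rewrite kapE; apply: (@lt_le_trans _ _ (2^-1 * expR (- (x / 4)) * (p * n%:R / 5))); last first.
  by rewrite ler_wpM2r ?ler_pM2l ?invr_gt0 ?ltr0n // divr_ge0 // mulr_ge0 // ltW.
apply: le_lt_trans tr2 _; rewrite expRN ltr_pdivrMr //.
have -> : 2^-1 / expR (x / 4) * (p * n%:R / 5) * p = p * (p * n%:R) / 10 / expR (x / 4).
  by field; rewrite gt_eqF.
rewrite ltr_pdivlMr // -[X in X < _]mulrA -expRD; have -> : x / 4 + x / 4 = x / 2 by field.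
have h : expR (x / 10) * expR (x / 2) <= p * (p * n%:R).
  by apply: le_trans p2n; rewrite -expRD ler_expR; move: x1000; lra.
have e2 : 0 < expR (x / 2) by apply: expR_gt0.
have h2 : 0 < x ^+ 2 * expR (x / 2).
  by rewrite mulr_gt0 // exprn_gt0 //; move: x1000; lra.
by have := ler_wpM2r (ltW e2) xe; move: h h2; clear; lra.
Qed.

End ShortMedium.

(** * Assembling the three cases for large [n] *)

Theorem theorem5p1 (R : realType) :
  exists n0 : nat, forall (n : nat), (n0 <= n)%N ->
  forall (G : sgraph) (p : R) (r t : nat),
    #|G| = n ->
    p = edge_density R G ->
    [\/ [/\ n%:R `^ (- 3^-1) <= p,
            r%:R <= 2 * p `^ (- 2^-1)
          & t%:R <= log2 n%:R / (4 * log2 (32 / (p * r%:R ^+ 2)))],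
        [/\ n%:R `^ (- 5^-1) <= p,
            4 * p `^ (- 2^-1) <= r%:R,
            r%:R <= Num.sqrt (p^-1 * log2 n%:R)
          & t%:R <= 16^-1 * expR (p * r%:R ^+ 2 / 8) * log2 n%:R]
      | [/\ 4 * Num.sqrt (p^-1 * log2 n%:R) <= r%:R
          & t%:R <= Num.min (p * n%:R / (64 * Num.sqrt (log2 n%:R)))
                            (n%:R / (2 * r%:R))]] ->
    has_weakly_bicomplete G r t /\ has_weakly_complete G (2 * r)%N t.

Proof.
(* This threshold makes [ln n >= 1000]. *)
exists (Num.trunc (expR 1000 : R)).+1 => n le_n G p r t cG pE cases.
suff bic : has_weakly_bicomplete G r t.
  by split=> //; apply: complete_of_bicomplete.
have [->|t0] := posnP t.
  by exists (fun=> set0), (fun=> set0); split=> -[].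
have tR1 : 1 <= t%:R :> R by rewrite ler1n.
have en : expR 1000 <= n%:R :> R.
  by apply: le_trans (ltW (truncnS_gt _)) _; rewrite ler_nat.
have nR0 : 0 < n%:R :> R by apply: lt_le_trans en; apply: expR_gt0.
have n9 : (9 <= n)%N.
  rewrite -(ler_nat R); apply: le_trans en; apply: le_trans (expR_ge1Dx _); lra.
have x1000 : 1000 <= ln (n%:R : R).
  by rewrite -[X in X <= _]expRK ler_ln ?posrE ?expR_gt0.
have L1 : 1 <= log2 (n%:R : R).
  have := ln2_le_34 R; have := ln2_ge_half R => h1 h2.
  by rewrite /log2 ler_pdivlMr; move: h1 h2 x1000; clear; lra.
case: cases => [[le_p le_r le_t]|[le_p ge_r le_r le_t]|[ge_r]].
- have [r0|r0] := posnP r; last exact: bicomplete_of_short x1000 le_p le_r le_t.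
  (* For [r = 0] the conventions [32 / 0 = 0] and [ln 0 = 0] turn the bound on [t] into 0. *)
  exfalso; move: le_t; rewrite r0 expr0n mulr0 invr0 mulr0 /log2 [ln 0]ln0 //.
  by rewrite !(mul0r, mulr0, invr0); move: tR1; clear; lra.
- exact: bicomplete_of_medium x1000 le_p ge_r le_r le_t.
rewrite le_min => /andP[le_t1 le_t2].
(* The bound [le_t1] is proportional to [p], so [p = 0] would force [t = 0]. *)
have p0 : 0 < p.
  rewrite lt_neqAle {2}pE edge_density_ge0 andbT; apply/eqP => p0.
  by move: le_t1; rewrite -p0 !mul0r; move: tR1; clear; lra.
exact: bicomplete_of_long ge_r le_t1 le_t2.
Qed.
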